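(* Let $\varphi$ be a smooth real-valued function on a domain $\Omega\subset\mathbb{C}$. Then the following are equivalent: (1) $\sqrt{-1}\partial\overline{\partial}\varphi=0$ on $\Omega$ (i.e. $\varphi$ is harmonic); (2) $L_\varphi\equiv1$ on $\Omega_\delta$; equivalently, for every $a\in\Omega$ and $r\in(0,\delta(a))$ there exists a unique holomorphic function $f$ on $\Delta(a;r)$ with $f(a)=1$ and $\int_{\Delta(a;r)}|f|^2e^{-\varphi}\leq\pi r^2e^{-\varphi(a)}$.
   Context: $\Delta(a;r)=\{z\in\mathbb{C}\mid|z-a|<r\}$; $\delta(a)=\sup\{r>0\mid\Delta(a;r)\subset\Omega\}$; $\Omega_\delta=\{(a,r)\in\Omega\times\mathbb{R}\mid0<r<\delta(a)\}$. $A^2(D,\varphi)$ is the space of holomorphic $f$ on $D$ with $\int_D|f|^2e^{-\varphi}<\infty$ (Lebesgue measure). The $L^2$-extension index is $$L_\varphi(a,r)=\inf\left\{\frac{\int_{\Delta(a;r)}|f|^2e^{-\varphi}}{\pi r^2e^{-\varphi(a)}}\ \middle|\ f\in A^2(\Delta(a;r),\varphi),\ f(a)=1\right\},\quad(a,r)\in\Omega_\delta.$$ *)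

(* Defs.v *)
(* The complex plane C is modelled as R * R
   (z = (Re z, Im z)) for an arbitrary R : realType. *)
From HB Require Import structures.
From mathcomp Require Import all_boot all_order all_algebra.
From mathcomp Require Import all_classical all_reals all_analysis.
Set Implicit Arguments. Unset Strict Implicit. Unset Printing Implicit Defensive.
Import Order.TTheory GRing.Theory Num.Theory.
Import numFieldNormedType.Exports.
Local Open Scope classical_set_scope.
Local Open Scope ring_scope.

Section Defs.
Variable R : realType.
Notation C := (R * R)%type.

Definition cmul (z w : C) : C := (z.1 * w.1 - z.2 * w.2, z.1 * w.2 + z.2 * w.1).

Definition cnorm2 (w : C) : R := w.1 ^+ 2 + w.2 ^+ 2.
Definition cabs (z : C) : R := Num.sqrt (cnorm2 z).

Definition disk (a : C) (r : R) : set C := [set z | cabs (z - a) < r].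

Definition cdifferentiable (f : C -> C) (z : C) : Prop :=
  exists l : C,
    (fun h : C => (cabs h)^-1 *: (f (z + h) - f z - cmul l h)) @ (0 : C)^' --> (0 : C).

Definition holomorphic_on (D : set C) (f : C -> C) : Prop :=
  forall z, D z -> cdifferentiable f z.

Fixpoint iterD (vs : seq C) (g : C -> R) : C -> R :=
  match vs with
  | [::] => g
  | v :: vs' => fun x => 'D_v (iterD vs' g) x
  end.

Definition smooth_on (O : set C) (g : C -> R) : Prop :=
  forall (vs : seq C) (x : C), O x -> differentiable (iterD vs g) x.

(* Laplacian: d^2 g/dx^2 + d^2 g/dy^2;  sqrt(-1) d dbar g = (1/2) (Lap g) dx /\ dy *)
Definition laplacian (g : C -> R) (x : C) : R :=
  iterD [:: (1, 0); (1, 0)] g x + iterD [:: (0, 1); (0, 1)] g x.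

Definition lebC : set (R * R)%type -> \bar R :=
  (@lebesgue_measure R \x @lebesgue_measure R)%E.

Definition wL2 (phi : C -> R) (D : set C) (f : C -> C) : \bar R :=
  (\int[lebC]_(z in D) (cnorm2 (f z) * expR (- phi z))%:E)%E.

Definition bdist (O : set C) (a : C) : \bar R :=
  ereal_sup [set r%:E | r in [set r : R | 0 < r /\ disk a r `<=` O]].

Definition A2 (D : set C) (phi : C -> R) : set (C -> C) :=
  [set f | holomorphic_on D f /\ (wL2 phi D f < +oo)%E].

Definition L2index (phi : C -> R) (a : C) (r : R) : \bar R :=
  ereal_inf [set (wL2 phi (disk a r) f * ((pi * r ^+ 2 * expR (- phi a))^-1)%:E)%E
            | f in [set f | A2 (disk a r) phi f /\ f a = (1, 0)]].

End Defs.

(* Main.v *)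
Require Import Defs.
From HB Require Import structures.
From mathcomp Require Import all_boot all_order all_algebra.
From mathcomp Require Import all_classical all_reals all_analysis.
From mathcomp Require Import measurable_realfun ring lra.
Set Implicit Arguments. Unset Strict Implicit. Unset Printing Implicit Defensive.
Import Order.TTheory GRing.Theory Num.Theory.
Import numFieldNormedType.Exports.
Local Open Scope classical_set_scope.
Local Open Scope ring_scope.

(** Let [H] be holomorphic on the disk [D] of centre [a] with [H a = 0]. Writing
    [f = e^H u] turns [|f|^2 e^-phi] into [|u|^2 e^(2 Re H - phi)]. If [w] is a
    radial weight, [u] is holomorphic and [u a = 1], the mean value property on
    circles gives [int_D |u|^2 w = int_D w + int_D |u - 1|^2 w]: so [u = 1] is the
    unique minimizer.

    If [phi] is harmonic, a harmonic conjugate gives [H] with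
    [2 Re H = phi - phi a]; then [w] is constant, the minimum is
    [pi r^2 e^(- phi a)] and [e^H] is the only function that attains it.

    Otherwise [c = laplacian phi a / 4] is nonzero at some [a], and Taylor's formula gives a
    polynomial [H] with [phi = phi a + 2 Re H + c |z - a|^2 + o(|z - a|^2)], so on a
    small disk [e^(2 Re H - phi + phi a)] is bounded by [e^(-c |z - a|^2 / 2)], from
    below if [c < 0] and from above if [c > 0]. In the first case every admissible
    [f] exceeds the bound. In the second case [e^H] stays strictly below it, and
    [e^H (1 + s (z - a))] with [s^2 = c / 2] still satisfies it because
    [(1 + t) e^-t <= 1].

    Holomorphy being pointwise differentiability, the circle means come from
    Goursat's bisection argument, applied to [u (a + (z - a) e^zeta)] on a rectangle;
    they pass to disks because the plane Lebesgue measure is rotation invariant, a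
    rotation being a product of three shears. *)

(** * Arithmetic and modulus of complex numbers as pairs of reals *)

Section complex.
Variable R : realType.
Notation C := (R * R)%type.
Implicit Types (z w h l : C) (f g : C -> C).

Lemma cnorm2_ge0 z : 0 <= cnorm2 z.
Proof. by rewrite addr_ge0// sqr_ge0. Qed.

Lemma cabs_ge0 z : 0 <= cabs z.
Proof. exact: sqrtr_ge0. Qed.

Lemma sqr_cabs z : cabs z ^+ 2 = cnorm2 z.
Proof. by rewrite sqr_sqrtr// cnorm2_ge0. Qed.

Lemma cabs_le z (b : R) : 0 <= b -> cnorm2 z <= b ^+ 2 -> cabs z <= b.
Proof.
by move=> b0 zb; rewrite -(ler_pXn2r (_ : 0 < 2)%N) ?nnegrE ?cabs_ge0// sqr_cabs.
Qed.

Lemma cnorm2M z w : cnorm2 (cmul z w) = cnorm2 z * cnorm2 w.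
Proof. by rewrite /cnorm2 /cmul /=; ring. Qed.

Lemma cabsM z w : cabs (cmul z w) = cabs z * cabs w.
Proof. by rewrite /cabs cnorm2M sqrtrM// cnorm2_ge0. Qed.

Lemma cabsN z : cabs (- z) = cabs z.
Proof. by rewrite /cabs /cnorm2 /= !sqrrN. Qed.

Lemma cabs0 : cabs (0 : C) = 0.
Proof. by rewrite /cabs /cnorm2 /= expr0n/= addr0 sqrtr0. Qed.

Lemma cabs_eq0 z : cabs z = 0 -> z = 0.
Proof.
move=> z0; have := sqr_cabs z; rewrite z0 expr0n/= => /esym/eqP.
rewrite /cnorm2 paddr_eq0 ?sqr_ge0// !sqrf_eq0 => /andP[/eqP z1 /eqP z2].
by case: z z1 z2 {z0} => a b /= -> ->.
Qed.

Lemma cabs_gt0 z : z != 0 -> 0 < cabs z.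
Proof.
move=> z0; rewrite lt_def cabs_ge0 andbT; apply: contra_neq z0.
exact: cabs_eq0.
Qed.

Lemma Re_le_cabs z : `|z.1| <= cabs z.
Proof.
rewrite -(ler_pXn2r (_ : 0 < 2)%N) ?nnegrE ?cabs_ge0// sqr_cabs.
by rewrite real_normK ?num_real// lerDl sqr_ge0.
Qed.

Lemma Im_le_cabs z : `|z.2| <= cabs z.
Proof.
rewrite -(ler_pXn2r (_ : 0 < 2)%N) ?nnegrE ?cabs_ge0// sqr_cabs.
by rewrite real_normK ?num_real// lerDr sqr_ge0.
Qed.

Lemma cabs_le_sum z : cabs z <= `|z.1| + `|z.2|.
Proof.
apply: cabs_le; first by rewrite addr_ge0.
rewrite /cnorm2 -(real_normK (num_real z.1)) -(real_normK (num_real z.2)).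
have : 0 <= `|z.1| * `|z.2| by rewrite mulr_ge0.
by move=> H; rewrite sqrrD; lra.
Qed.

Lemma ler_cabsD z w : cabs (z + w) <= cabs z + cabs w.
Proof.
apply: cabs_le; first by rewrite addr_ge0// cabs_ge0.
have le : z.1 * w.1 + z.2 * w.2 <= cabs z * cabs w.
  rewrite -cabsM (le_trans (ler_norm _))//.
  apply: le_trans (_ : cabs (cmul (z.1, - z.2) w) <= _).
    have -> : z.1 * w.1 + z.2 * w.2 = (cmul (z.1, - z.2) w).1.
      by rewrite /cmul /=; ring.
    exact: Re_le_cabs.
  by rewrite !cabsM /cabs /cnorm2 /= sqrrN.
rewrite sqrrD !sqr_cabs.
have -> : cnorm2 (z + w) = cnorm2 z + cnorm2 w + (z.1 * w.1 + z.2 * w.2) *+ 2.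
  by rewrite /cnorm2 /=; ring.
by move: le; rewrite !mulr2n; lra.
Qed.

Lemma ler_cabsB z w : cabs (z - w) <= cabs z + cabs w.
Proof. by rewrite (le_trans (ler_cabsD _ _))// cabsN. Qed.

Lemma cmulDl z w l : cmul (z + w) l = cmul z l + cmul w l.
Proof. by rewrite /cmul; congr pair => /=; ring. Qed.

Lemma cmulDr z w l : cmul l (z + w) = cmul l z + cmul l w.
Proof. by rewrite /cmul; congr pair => /=; ring. Qed.

Lemma cmulBr z w l : cmul l (z - w) = cmul l z - cmul l w.
Proof. by rewrite /cmul; congr pair => /=; ring. Qed.

Lemma cmulA z w l : cmul z (cmul w l) = cmul (cmul z w) l.
Proof. by rewrite /cmul; congr pair => /=; ring. Qed.

Lemma cmul1 z : cmul (1, 0) z = z.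
Proof. by case: z => a b; rewrite /cmul /=; congr pair => /=; ring. Qed.

Lemma cmul0 z : cmul z (0, 0) = (0, 0).
Proof. by rewrite /cmul; congr pair => /=; ring. Qed.

Lemma cmulC z w : cmul z w = cmul w z.
Proof. by rewrite /cmul; congr pair => /=; ring. Qed.

Lemma norm_le_cabs z : `|z| <= cabs z.
Proof. by rewrite prod_normE ge_max Re_le_cabs Im_le_cabs. Qed.

Lemma cabs_le_norm z : cabs z <= 2 * `|z|.
Proof.
apply: (le_trans (cabs_le_sum z)); rewrite prod_normE mulr_natl mulr2n.
by rewrite lerD// le_max lexx ?orbT.
Qed.

(** The product topology comes from the max norm, which is comparable to the modulus; this lets
    every limit below be handled with round disks. *)
Lemma nbhs_cabsP z (A : set C) :
  nbhs z A <-> exists2 d : R, 0 < d & forall h, cabs h < d -> A (z + h).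
Proof.
split=> [/nbhs_normP[d /= d0 dA]|[d d0 dA]].
  exists d => // h hd; apply: dA => /=.
  by rewrite opprD addrA subrr sub0r normrN (le_lt_trans (norm_le_cabs _)).
rewrite -filter_from_norm_nbhs; exists (d / 2) => /=; first by rewrite divr_gt0.
move=> w /= zw; have := dA (w - z); rewrite addrCA subrr addr0; apply.
apply: (le_lt_trans (cabs_le_norm _)); rewrite distrC in zw.
by rewrite mulrC -ltr_pdivlMr.
Qed.

Lemma open_disk z (r : R) : open (disk z r).
Proof.
rewrite openE => w /= zw; apply/nbhs_cabsP; exists (r - cabs (w - z)).
  by rewrite subr_gt0.
move=> h; rewrite /disk/= => hr; rewrite addrAC.
by apply: le_lt_trans (ler_cabsD _ _) _; lra.
Qed.

(** * Complex derivatives in epsilon-delta form *)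

(** Differentiability with an explicit derivative and without division by [cabs h], so that [h = 0]
    needs no separate treatment. *)
Definition cder f z l := forall e : R, 0 < e -> exists2 d : R, 0 < d &
  forall h, cabs h < d -> cabs (f (z + h) - f z - cmul l h) <= e * cabs h.

Lemma cdifferentiableP f z : cdifferentiable f z <-> exists l, cder f z l.
Proof.
split=> -[l H]; exists l.
  move=> e e0; move/cvgrPdist_lt : H => /(_ (e / 2)).
  rewrite divr_gt0// => /(_ isT).
  move=> /nbhs_cabsP[d d0 H]; exists d => // h hd.
  have [->|h0] := eqVneq h 0.
    by rewrite addr0 subrr cmul0 subr0 cabs0 mulr0.
  have {}H := H h hd.
  rewrite add0r in H; have := H h0; rewrite sub0r normrN normrZ.
  have ch := cabs_gt0 h0.
  rewrite ger0_norm ?invr_ge0 ?cabs_ge0// mulrC ltr_pdivrMr// => K.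
  apply: (le_trans (cabs_le_norm _)).
  by move: K; lra.
apply/cvgrPdist_le => e e0.
have [d d0 K] := H e e0; apply/nbhs_cabsP; exists d => // h hd; rewrite add0r => h0.
rewrite sub0r normrN normrZ ger0_norm ?invr_ge0 ?cabs_ge0//.
rewrite mulrC ler_pdivrMr ?cabs_gt0//.
by apply: (le_trans (norm_le_cabs _)); exact: K.
Qed.

Lemma holomorphic_cder (D : set C) f z : holomorphic_on D f -> D z ->
  exists l, cder f z l.
Proof. by move=> H /H /cdifferentiableP. Qed.

Lemma cder_holomorphic (D : set C) f : (forall z, D z -> exists l, cder f z l) ->
  holomorphic_on D f.
Proof. by move=> H z /H /cdifferentiableP. Qed.

Lemma cder_cst c z : cder (fun=> c) z 0.
Proof.
move=> e e0; exists 1 => // h _; rewrite subrr sub0r.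
have -> : - cmul 0 h = 0 by rewrite /cmul; congr pair => /=; ring.
by rewrite cabs0 mulr_ge0 ?cabs_ge0// ltW.
Qed.

Lemma cder_mull c z : cder (cmul c) z c.
Proof.
move=> e e0; exists 1 => // h _.
rewrite cmulDr (_ : _ - _ - _ = 0); last by rewrite /cmul; congr pair => /=; ring.
by rewrite cabs0 mulr_ge0 ?cabs_ge0// ltW.
Qed.

Lemma cder_shift a z : cder (fun z => z - a) z (1, 0).
Proof.
move=> e e0; exists 1 => // h _.
rewrite cmul1 (_ : _ - h = 0) ?cabs0 ?mulr_ge0 ?cabs_ge0 ?ltW//.
by case: z h a => ? ? [? ?] [? ?]; congr pair => /=; ring.
Qed.

Lemma cder_sqr z : cder (fun z => cmul z z) z (cmul (2, 0) z).
Proof.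
move=> e e0; exists e => // h he.
have -> : cmul (z + h) (z + h) - cmul z z - cmul (cmul (2, 0) z) h = cmul h h.
  by rewrite /cmul; congr pair => /=; ring.
by rewrite cabsM ler_wpM2r ?cabs_ge0// ltW.
Qed.

Lemma cderD f g z l m : cder f z l -> cder g z m -> cder (fun z => f z + g z) z (l + m).
Proof.
move=> Hf Hg e e0; have e20 : 0 < e / 2 by rewrite divr_gt0.
have [d1 d10 H1] := Hf _ e20; have [d2 d20 H2] := Hg _ e20.
exists (Num.min d1 d2); first by rewrite lt_min d10.
move=> h; rewrite lt_min => /andP[/H1 {}H1 /H2 {}H2].
rewrite cmulDl (_ : _ - _ - _ = (f (z + h) - f z - cmul l h) +
  (g (z + h) - g z - cmul m h)); last first.
  by rewrite addrACA !opprD; congr (_ + _); rewrite addrACA.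
by apply: (le_trans (ler_cabsD _ _)); move: H1 H2; lra.
Qed.

Lemma cder_comp f g z l m : cder f z l -> cder g (f z) m -> cder (g \o f) z (cmul m l).
Proof.
move=> Hf Hg e e0.
have lm0 : 0 < cabs l + 1 by rewrite ltr_wpDl ?cabs_ge0.
have m0 : 0 < cabs m + 1 by rewrite ltr_wpDl ?cabs_ge0.
have eg : 0 < e / 2 / (cabs l + 1) by rewrite !divr_gt0.
have [dg dg0 H2] := Hg _ eg.
(* The bound 1 makes the increment of [f] at most [(cabs l + 1) * cabs h]; the other bound keeps the
   error of [f], once multiplied by [m], below [e / 2 * cabs h]. *)
have ef : 0 < Num.min 1 (e / 2 / (cabs m + 1)) by rewrite lt_min ltr01 !divr_gt0.
have [df df0 H1] := Hf _ ef.
exists (Num.min df (dg / (cabs l + 1))); first by rewrite lt_min df0 divr_gt0.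
move=> h; rewrite lt_min => /andP[hd]; rewrite ltr_pdivlMr// => hl.
have {}H1 := H1 _ hd.
have H1a : cabs (f (z + h) - f z - cmul l h) <= cabs h.
  by apply: (le_trans H1); rewrite ler_piMl ?cabs_ge0// ge_min lexx.
have H1b : cabs (f (z + h) - f z - cmul l h) * (cabs m + 1) <= e / 2 * cabs h.
  rewrite -ler_pdivlMr//; apply: (le_trans H1).
  rewrite -[leRHS]mulrAC ler_wpM2r ?cabs_ge0//.
  by rewrite ge_min lexx orbT.
pose k := f (z + h) - f z.
have kh : cabs k <= (cabs l + 1) * cabs h.
  rewrite /k -(subrK (cmul l h) (f (z + h) - f z)).
  by apply: (le_trans (ler_cabsD _ _)); rewrite cabsM; move: H1a; lra.
have kd : cabs k < dg by apply: (le_lt_trans kh); rewrite mulrC.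
have := H2 _ kd; rewrite {1}/k addrCA subrr addr0 => {}H2.
have {}H2 : cabs (g (f (z + h)) - g (f z) - cmul m k) <= e / 2 * cabs h.
  apply: (le_trans H2); rewrite -mulrA ler_wpM2l//; first by rewrite divr_ge0// ltW.
  by rewrite ler_pdivrMl.
rewrite /= -cmulA (_ : _ - _ = (g (f (z + h)) - g (f z) - cmul m k) +
    cmul m (k - cmul l h)); last by rewrite cmulBr addrA subrK.
apply: (le_trans (ler_cabsD _ _)); rewrite cabsM.
have : cabs m * cabs (k - cmul l h) <= e / 2 * cabs h.
  apply: le_trans H1b; rewrite mulrC; apply: ler_wpM2l; first exact: cabs_ge0.
  by rewrite lerDl.
by move: H2; lra.
Qed.

Lemma cderMl c f z l : cder f z l -> cder (fun z => cmul c (f z)) z (cmul c l).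
Proof. by move=> H; exact: (cder_comp H (cder_mull _ _)). Qed.

(* Polarization reduces the product rule to the chain rule for the square. *)
Lemma cderM f g z l m : cder f z l -> cder g z m ->
  exists k, cder (fun z => cmul (f z) (g z)) z k.
Proof.
move=> Hf Hg.
have Hp := cder_comp (cderD Hf Hg) (cder_sqr _).
have Hm := cder_comp (cderD Hf (cderMl (-1, 0) Hg)) (cder_sqr _).
have := cderD (cderMl (4^-1, 0) Hp) (cderMl (- 4^-1, 0) Hm).
set k := _ + _ => H; exists k; move: H; congr (cder _ z k).
apply/funext => w; rewrite /comp /=; case: (f w) (g w) => a b [c d].
by rewrite /cmul /=; congr pair => /=; field.
Qed.

(** * The complex exponential *)

Definition cexp z : C := (expR z.1 * cos z.2, expR z.1 * sin z.2).

Lemma cexp0 : cexp 0 = (1, 0).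
Proof. by rewrite /cexp /= expR0 cos0 sin0 mulr1 mulr0. Qed.

Lemma cexpD z w : cexp (z + w) = cmul (cexp z) (cexp w).
Proof. by rewrite /cexp /cmul /= expRD cosD sinD; congr pair; ring. Qed.

Lemma cnorm2_cexp z : cnorm2 (cexp z) = expR (2 * z.1).
Proof.
rewrite /cnorm2 /cexp /= !exprMn -mulrDr cos2Dsin2 mulr1.
by rewrite -expRM_natl.
Qed.

Lemma is_derive_err (u : R -> R) (x l e : R) : is_derive x 1 u l -> 0 < e ->
  exists2 d : R, 0 < d & forall h : R, `|h| < d -> `|u (x + h) - u x - l * h| <= e * `|h|.
Proof.
move=> [/derivable_nbhsP/eqaddoP df fl] e0; rewrite fl in df.
have := df _ e0; rewrite nearE => /nbhs_ballP[d /= d0 H]; exists d => // h hd.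
have := H h; rewrite /ball /= sub0r normrN => /(_ hd).
by rewrite !fctE /= [_%:A]mulr1 (addrC h x) opprD addrA [h *: l]mulrC.
Qed.

Lemma cder_cexp0 : cder cexp 0 (1, 0).
Proof.
move=> e e0.
(* With [t <= 1] the factors [1 + x + r1] and [x + r1] are at most 3 and [2 * k]; the four error
   terms then add up to at most [9 * t * k]. *)
pose t := Num.min 1 (e / 10).
have t0 : 0 < t by rewrite lt_min ltr01/= divr_gt0.
have t1 : t <= 1 by rewrite ge_min lexx.
have te : t * 10 <= e by rewrite -ler_pdivlMr// ge_min lexx orbT.
clearbody t; have [d1 d10 H1] := is_derive_err (is_derive_expR 0) t0.
have [d2 d20 H2] := is_derive_err (is_derive_cos 0) t0.
have [d3 d30 H3] := is_derive_err (is_derive_sin 0) t0.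
exists (Num.min t (Num.min d1 (Num.min d2 d3))); first by rewrite !lt_min t0 d10 d20 d30.
move=> h; rewrite !lt_min => /and4P[ht hd1 hd2 hd3].
have hx := Re_le_cabs h; have hy := Im_le_cabs h.
have := H1 h.1 (le_lt_trans hx hd1).
have := H2 h.2 (le_lt_trans hy hd2).
have := H3 h.2 (le_lt_trans hy hd3).
rewrite !add0r expR0 cos0 sin0 oppr0 !mul0r !mul1r !subr0 addr0 cmul1 cexp0 => h3 h2 h1.
apply: (le_trans (cabs_le_sum _)) => /=.
set x := h.1 in hx h1 *; set y := h.2 in hy h2 h3 *; set k := cabs h in ht hx hy *.
have k0 : 0 <= k by exact: cabs_ge0.
set r1 := expR x - 1 - x in h1; set r2 := cos y - 1 in h2; set r3 := sin y - y in h3.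
have -> : expR x * cos y - 1 - x = r1 + r2 * (1 + x + r1).
  by rewrite /r1 /r2; ring.
have -> : expR x * sin y - 0 - y = r3 * (1 + x + r1) + (x + r1) * y.
  by rewrite /r1 /r3; ring.
have tx : t * `|x| <= t * k by rewrite ler_wpM2l// ltW.
have ty : t * `|y| <= t * k by rewrite ler_wpM2l// ltW.
have tk : t * k <= k by rewrite ler_piMl.
have b1 : `|1 + x + r1| <= 3.
  apply: (le_trans (ler_normD _ _)); have := ler_normD 1 x; rewrite normr1.
  by move: h1 tx tk; lra.
have b2 : `|x + r1| <= 2 * k.
  by apply: (le_trans (ler_normD _ _)); move: h1 tx tk; lra.
have c1 : `|r2 * (1 + x + r1)| <= t * k * 3.
  by rewrite normrM ler_pM//; apply: (le_trans h2).
have c2 : `|r3 * (1 + x + r1)| <= t * k * 3.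
  by rewrite normrM ler_pM//; apply: (le_trans h3).
have c3 : `|(x + r1) * y| <= 2 * k * t.
  by rewrite normrM ler_pM//; apply: (le_trans hy); exact: ltW.
have ek : t * k * 10 <= e * k by rewrite mulrAC ler_wpM2r.
have := ler_normD r1 (r2 * (1 + x + r1)).
have := ler_normD (r3 * (1 + x + r1)) ((x + r1) * y).
have tk0 : 0 <= t * k by rewrite mulr_ge0// ltW.
by move: h1 c1 c2 c3 ek tx; lra.
Qed.

(** The functional equation [cexpD] carries the derivative at 0 to any point. *)
Lemma cder_cexp z : cder cexp z (cexp z).
Proof.
move=> e e0; have c0 : 0 < cabs (cexp z) + 1 by rewrite ltr_wpDl ?cabs_ge0.
have [d d0 H] := cder_cexp0 (divr_gt0 e0 c0); exists d => // h /H.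
rewrite add0r cexp0 cmul1 => {}H.
rewrite cexpD (_ : _ - _ = cmul (cexp z) (cexp h - (1, 0) - h)); last first.
  by rewrite !cmulBr (cmulC _ (1, 0)) cmul1.
rewrite cabsM; apply: le_trans (_ : (cabs (cexp z) + 1) * cabs (cexp h - (1, 0) - h) <= _).
  by rewrite ler_wpM2r ?cabs_ge0// lerDl.
by rewrite mulrC -ler_pdivlMr// mulrAC.
Qed.

(** * Real gradients and the Cauchy-Riemann equations *)

Definition has_grad (g : C -> R) z (p q : R) := forall e : R, 0 < e ->
  exists2 d : R, 0 < d & forall h, cabs h < d ->
    `|g (z + h) - g z - (p * h.1 + q * h.2)| <= e * cabs h.

(** The Cauchy-Riemann equations: multiplication by [l] is the real matrix with rows [(l.1, - l.2)]
    and [(l.2, l.1)]. *)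
Lemma cderP f z l : cder f z l <->
  has_grad (fun z => (f z).1) z l.1 (- l.2) /\ has_grad (fun z => (f z).2) z l.2 l.1.
Proof.
split=> [H|[H1 H2]].
  split=> e e0; have [d d0 K] := H _ e0; exists d => // h /K;
    apply: le_trans; [apply: le_trans (Re_le_cabs _)|apply: le_trans (Im_le_cabs _)];
    by rewrite le_eqVlt; apply/orP; left; apply/eqP; congr `|_|; rewrite /cmul /=; ring.
move=> e e0; have e2 : 0 < e / 2 by rewrite divr_gt0.
have [d1 d10 {}H1] := H1 _ e2; have [d2 d20 {}H2] := H2 _ e2.
exists (Num.min d1 d2); first by rewrite lt_min d10.
move=> h; rewrite lt_min => /andP[/H1 {}H1 /H2 {}H2].
apply: (le_trans (cabs_le_sum _)); rewrite /cmul /=.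
by move: H1 H2; rewrite mulNr (addrC (l.2 * _)); lra.
Qed.

Lemma has_grad_continuous (g : C -> R) z p q : has_grad g z p q ->
  {for z, continuous g}.
Proof.
move=> H; apply/cvgrPdist_le => e e0; apply/nbhs_cabsP.
have [d d0 K] := H _ ltr01.
pose M := `|p| + `|q| + 1.
have M0 : 0 < M by rewrite ltr_wpDl// addr_ge0.
exists (Num.min d (e / M)); first by rewrite lt_min d0 divr_gt0.
move=> h; rewrite lt_min => /andP[/K {}K]; rewrite ltr_pdivlMr// => he.
rewrite distrC -(subrK (p * h.1 + q * h.2) (_ - _)).
apply: (le_trans (ler_normD _ _)).
have : `|p * h.1 + q * h.2| <= (`|p| + `|q|) * cabs h.
  apply: (le_trans (ler_normD _ _)); rewrite !normrM mulrDl.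
  by rewrite lerD// ler_wpM2l// (Re_le_cabs,Im_le_cabs).
by move: K he; rewrite /M mul1r !mulrDr mulr1 [cabs h * _]mulrC [cabs h * `|q|]mulrC !mulrDl; lra.
Qed.

Lemma differentiable_has_grad (g : C -> R) z : differentiable g z ->
  has_grad g z ('D_(1, 0) g z) ('D_(0, 1) g z).
Proof.
move=> dg e e0.
have /eqaddoP/(_ _ e0) := diff_locally dg.
rewrite nearE => /nbhs_cabsP[d d0 H].
exists d => // h hd; have := H h hd; rewrite add0r !fctE /= => {}H.
have -> : 'D_(1, 0) g z * h.1 + 'D_(0, 1) g z * h.2 = 'd g z h.
  have {3}-> : h = h.1 *: (1, 0) + h.2 *: (0, 1) :> C.
    by case: (h) => a b; congr pair; rewrite /= /GRing.scale /=; ring.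
  by rewrite !deriveE// linearD !linearZ/= [_ *: _]mulrC [X in _ = _ + X]mulrC.
rewrite [z + h]addrC -addrA -opprD; apply: (le_trans H).
by rewrite ler_wpM2l ?norm_le_cabs// ltW.
Qed.

End complex.

(** * Oriented integrals of continuous functions of one real variable *)

Section signed_integral.
Variable R : realType.
Notation mu := (@lebesgue_measure R).
Implicit Types (g : R -> R) (a b c x : R).

(** Continuity is two-sided even at the endpoints, hence stronger than continuity within the
    segment. *)
Definition cont_on g a b := forall x, a <= x <= b -> {for x, continuous g}.

Lemma cont_on_integrable g a b : cont_on g a b -> mu.-integrable `[a, b] (EFin \o g).
Proof.
move=> cg; apply: continuous_compact_integrable; first exact: segment_compact.
by apply: continuous_in_subspaceT => x; rewrite inE /= in_itv /= => /cg.
Qed.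

(** The integral is oriented because increments [h.1] and [h.2] of either sign occur as bounds. *)
Definition sint g a b : R :=
  if a <= b then \int[mu]_(x in `[a, b]) g x else - \int[mu]_(x in `[b, a]) g x.

Lemma Rintegral_itvD g a b c : cont_on g a c -> a <= b -> b <= c ->
  \int[mu]_(x in `[a, b]) g x + \int[mu]_(x in `[b, c]) g x =
  \int[mu]_(x in `[a, c]) g x.
Proof.
move=> cg ab bc.
have ig := cont_on_integrable cg.
have := @Rintegral_itvB _ g (BLeft a) (BRight c) b ig.
rewrite !bnd_simp => /(_ ab bc) H.
rewrite -(@Rintegral_itv_obnd_cbnd _ b); first by rewrite -H addrC subrK.
by apply: integrableS ig => //; apply: subset_itvr; rewrite bnd_simp.
Qed.

Lemma sintE g l m a b : cont_on g l m -> l <= a <= m -> l <= b <= m ->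
  sint g a b = \int[mu]_(x in `[l, b]) g x - \int[mu]_(x in `[l, a]) g x.
Proof.
move=> cg /andP[la am] /andP[lb bm]; rewrite /sint.
have cS (x : R) : x <= m -> cont_on g l x.
  by move=> xm y /andP[ly yx]; apply: cg; rewrite ly (le_trans yx).
case: ifPn => ab.
  by rewrite -(Rintegral_itvD (cS _ bm) la ab) addrC addKr.
have {}ab : b <= a by rewrite ltW// ltNge.
by rewrite -(Rintegral_itvD (cS _ am) lb ab) opprD addrA subrr sub0r.
Qed.

Lemma sint_chasles g l m a b c : cont_on g l m -> l <= a <= m -> l <= b <= m ->
  l <= c <= m -> sint g a b + sint g b c = sint g a c.
Proof.
move=> cg la lb lc; rewrite (sintE cg la lb) (sintE cg lb lc) (sintE cg la lc).
by ring.
Qed.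

Lemma sintN g a b : sint g b a = - sint g a b.
Proof.
rewrite /sint; case: ifPn => ba; case: ifPn => ab //; last 2 first.
- by rewrite opprK.
- by move: ba ab; rewrite -!ltNge => /ltW; rewrite leNgt => /negbTE ->.
have -> : a = b by apply/le_anti; rewrite ab ba.
by rewrite set_itv1 Rintegral_set1 oppr0.
Qed.

Lemma sintB g1 g2 a b : a <= b -> cont_on g1 a b -> cont_on g2 a b ->
  sint (fun x => g1 x - g2 x) a b = sint g1 a b - sint g2 a b.
Proof.
move=> ab c1 c2; rewrite /sint ab RintegralB//.
- exact: cont_on_integrable.
- exact: cont_on_integrable.
Qed.

(** The basic estimate behind Goursat's argument, the differentiation of primitives and the limit of
    circle means: integrate [g - k], whose modulus is at most [e]. *)
Lemma sint_err g a b (k e : R) : cont_on g (Num.min a b) (Num.max a b) ->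
  (forall x, Num.min a b <= x <= Num.max a b -> `|g x - k| <= e) ->
  `|sint g a b - k * (b - a)| <= e * `|b - a|.
Proof.
wlog ab : a b / a <= b => [H cg ge|].
  have [ab|/ltW ba] := leP a b; first exact: H.
  have := H _ _ ba; rewrite minC maxC => /(_ cg ge).
  rewrite (sintN g a b).
  by rewrite -normrN distrC; congr (`|_| <= _); ring.
rewrite (min_idPl ab) (max_idPr ab) => cg ge.
rewrite /sint ab (_ : `|b - a| = b - a); last by rewrite ger0_norm ?subr_ge0.
have ig := cont_on_integrable cg.
have mab : fine (mu `[a, b]) = b - a.
  rewrite lebesgue_measure_itv /= lte_fin; case: ifPn => //=.
  by rewrite -leNgt => ba; apply/esym/eqP; rewrite subr_eq0 eq_le ba ab.
have ik r : mu.-integrable `[a, b] (EFin \o cst r).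
  by apply: cont_on_integrable => x _; exact: cst_continuous.
have Ek r : \int[mu]_(x in `[a, b]) r = r * (b - a).
  by rewrite Rintegral_cst ?mab//; exact: measurable_itv.
have -> : \int[mu]_(x in `[a, b]) g x - k * (b - a) = \int[mu]_(x in `[a, b]) (g x - k).
  by rewrite (RintegralB _ ig (ik k)) ?Ek//; exact: measurable_itv.
have igk : mu.-integrable `[a, b] (EFin \o (fun x => g x - k)).
  apply: cont_on_integrable => x xI; apply: cvgB; [exact: cg|exact: cvg_cst].
apply: (le_trans (le_normr_Rintegral _ igk)); first exact: measurable_itv.
have cn : cont_on (fun x => `|g x - k|) a b.
  move=> x xI; apply: (@continuous_comp _ _ _ (fun x => g x - k) Num.norm).
    by apply: cvgB; [exact: cg|exact: cvg_cst].
  exact: norm_continuous.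
apply: (@le_trans _ _ (\int[mu]_(x in `[a, b]) e)); last by rewrite Ek.
apply: le_Rintegral; [exact: measurable_itv|exact: cont_on_integrable|exact: ik|].
by move=> x /=; rewrite in_itv/=; exact: ge.
Qed.

Lemma cont_row (u : R * R -> R) (x y : R) : {for (x, y), continuous u} ->
  {for x, continuous (fun t => u (t, y))}.
Proof.
move=> /cvgrPdist_le cg; apply/cvgrPdist_le => e e0.
have /nbhs_cabsP[d d0 H] := cg e e0.
apply/nbhs_ballP; exists d => //= t; rewrite /ball /= => xt.
have -> : (t, y) = (x, y) + (t - x, 0) by congr (_, _) => /=; ring.
apply: H.
by rewrite (le_lt_trans (cabs_le_sum _))//= normr0 addr0 distrC.
Qed.

Lemma cont_col (u : R * R -> R) (x y : R) : {for (x, y), continuous u} ->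
  {for y, continuous (fun t => u (x, t))}.
Proof.
move=> /cvgrPdist_le cg; apply/cvgrPdist_le => e e0.
have /nbhs_cabsP[d d0 H] := cg e e0.
apply/nbhs_ballP; exists d => //= t; rewrite /ball /= => xt.
have -> : (x, t) = (x, y) + (0, t - y) by congr (_, _) => /=; ring.
apply: H.
by rewrite (le_lt_trans (cabs_le_sum _))//= normr0 add0r distrC.
Qed.

End signed_integral.

(** * Goursat's theorem for closed forms on rectangles *)

Section goursat.
Variable R : realType.
Notation C := (R * R)%type.
Variables P Q : C -> R.
Notation mu := (@lebesgue_measure R).

(** The circulation of [P dx + Q dy] around a rectangle, counterclockwise when [x0 <= x1] and
    [y0 <= y1]. *)
Definition loop (x0 y0 x1 y1 : R) :=
  sint (fun x => P (x, y0)) x0 x1 + sint (fun y => Q (x1, y)) y0 y1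
  - sint (fun x => P (x, y1)) x0 x1 - sint (fun y => Q (x0, y)) y0 y1.

(** Closedness at a single point: [P] and [Q] are differentiable at [z] and the shared [q] is both
    the y-derivative of [P] and the x-derivative of [Q]. Nothing is asked of the continuity of these
    derivatives. *)
Definition closed_at (z : C) :=
  exists p q s, has_grad P z p q /\ has_grad Q z q s.

Lemma closed_at_cont z : closed_at z -> {for z, continuous P} /\ {for z, continuous Q}.
Proof. by move=> [p [q [s [/has_grad_continuous ? /has_grad_continuous]]]]. Qed.

(* The affine parts of [P] and [Q] at [z] contribute nothing to the loop. *)
Lemma loop_err (z : C) e : closed_at z -> 0 < e -> exists2 d : R, 0 < d &
  forall x y s t, 0 <= s -> 0 <= t -> x <= z.1 <= x + s -> y <= z.2 <= y + t ->
    s + t < d ->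
    (forall w : C, x <= w.1 <= x + s -> y <= w.2 <= y + t -> closed_at w) ->
    `|loop x y (x + s) (y + t)| <= e * (s + t) ^+ 2.
Proof.
move=> [p [q [u [gP gQ]]]] e0; have e20 : 0 < e / 2 by rewrite divr_gt0.
have [d1 d10 H1] := gP _ e20; have [d2 d20 H2] := gQ _ e20.
exists (Num.min d1 d2); first by rewrite lt_min d10.
move=> x y s t s0 t0 /andP[xz zx] /andP[yz zy]; rewrite lt_min => /andP[std1 std2] cl.
have cP v : y <= v <= y + t -> cont_on (fun x => P (x, v)) x (x + s).
  by move=> vI w wI; apply: cont_row; apply: (closed_at_cont _).1; exact: cl.
have cQ v : x <= v <= x + s -> cont_on (fun y => Q (v, y)) y (y + t).
  by move=> vI w wI; apply: cont_col; apply: (closed_at_cont _).2; exact: cl.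
have xs : x <= x + s by rewrite lerDl.
have yt : y <= y + t by rewrite lerDl.
have y1 : y <= y <= y + t by rewrite lexx.
have y2 : y <= y + t <= y + t by rewrite lexx andbT.
have x1 : x <= x <= x + s by rewrite lexx.
have x2 : x <= x + s <= x + s by rewrite lexx andbT.
have hz w1 w2 : x <= w1 <= x + s -> y <= w2 <= y + t -> cabs ((w1, w2) - z) <= s + t.
  move=> /andP[w1a w1b] /andP[w2a w2b].
  apply: (le_trans (cabs_le_sum _)); rewrite /= lerD// ler_norml; apply/andP; split; lra.
have est (g : C -> R) (d a b : R) w1 w2 : s + t < d ->
    (forall h, cabs h < d -> `|g (z + h) - g z - (a * h.1 + b * h.2)| <= e / 2 * cabs h) ->
    x <= w1 <= x + s -> y <= w2 <= y + t ->
    `|g (w1, w2) - g z - (a * (w1 - z.1) + b * (w2 - z.2))| <= e / 2 * (s + t).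
  move=> sd H w1I w2I; have k := hz _ _ w1I w2I.
  have := H _ (le_lt_trans k sd); rewrite addrCA subrr addr0 => {}H.
  by apply: (le_trans H); rewrite ler_wpM2l// ltW.
have -> : loop x y (x + s) (y + t) = sint (fun x => P (x, y) - P (x, y + t)) x (x + s) +
    sint (fun v => Q (x + s, v) - Q (x, v)) y (y + t).
  rewrite (sintB xs (cP _ y1) (cP _ y2)) (sintB yt (cQ _ x2) (cQ _ x1)) /loop.
  by ring.
have E1 : `|sint (fun x => P (x, y) - P (x, y + t)) x (x + s) - (- q * t) * (x + s - x)| <=
    e * (s + t) * `|x + s - x|.
  apply: sint_err; rewrite (min_idPl xs) (max_idPr xs).
    by move=> w wI; apply: cvgB; [exact: (cP _ y1)|exact: (cP _ y2)].
  move=> w wI; have := est P d1 p q w y std1 H1 wI y1.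
  have := est P d1 p q w (y + t) std1 H1 wI y2.
  set A := P (w, y + t) - _ - _; set B := P (w, y) - P z - _ => A1 B1.
  have -> : P (w, y) - P (w, y + t) - - q * t = B - A by rewrite /A /B; ring.
  by apply: (le_trans (ler_normB _ _)); move: A1 B1; lra.
have E2 : `|sint (fun v => Q (x + s, v) - Q (x, v)) y (y + t) - (q * s) * (y + t - y)| <=
    e * (s + t) * `|y + t - y|.
  apply: sint_err; rewrite (min_idPl yt) (max_idPr yt).
    by move=> w wI; apply: cvgB; [exact: (cQ _ x2)|exact: (cQ _ x1)].
  move=> w wI; have := est Q d2 q u (x + s) w std2 H2 x2 wI.
  have := est Q d2 q u x w std2 H2 x1 wI.
  set A := Q (x, w) - _ - _; set B := Q (x + s, w) - Q z - _ => A1 B1.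
  have -> : Q (x + s, w) - Q (x, w) - q * s = B - A by rewrite /A /B; ring.
  by apply: (le_trans (ler_normB _ _)); move: A1 B1; lra.
move: E1 E2; rewrite !(addrAC _ _ (- _)) !subrr !add0r (ger0_norm s0) (ger0_norm t0).
set A := sint _ _ _; set B := sint _ _ _ => E1 E2.
have -> : A + B = (A - - q * t * s) + (B - q * s * t) by ring.
apply: (le_trans (ler_normD _ _)).
by rewrite (_ : e * _ = e * (s + t) * s + e * (s + t) * t); [exact: lerD|ring].
Qed.

(** Each inner edge belongs to two of the four small rectangles, with opposite orientations. *)
Lemma loop_split x0 y0 x1 y1 x2 y2 : x0 <= x1 <= x2 -> y0 <= y1 <= y2 ->
  (forall w : C, x0 <= w.1 <= x2 -> y0 <= w.2 <= y2 -> closed_at w) ->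
  loop x0 y0 x2 y2 = loop x0 y0 x1 y1 + loop x1 y0 x2 y1 +
    loop x0 y1 x1 y2 + loop x1 y1 x2 y2.
Proof.
move=> /andP[x01 x12] /andP[y01 y12] H.
have cP y : y0 <= y <= y2 -> cont_on (fun x => P (x, y)) x0 x2.
  by move=> yI x xI; apply: cont_row; apply: (closed_at_cont _).1; exact: H.
have cQ x : x0 <= x <= x2 -> cont_on (fun y => Q (x, y)) y0 y2.
  by move=> xI y yI; apply: cont_col; apply: (closed_at_cont _).2; exact: H.
have x02 := le_trans x01 x12; have y02 := le_trans y01 y12.
have cx (f : R -> R) : cont_on f x0 x2 -> sint f x0 x2 = sint f x0 x1 + sint f x1 x2.
  move=> cf; apply/esym/(sint_chasles cf); apply/andP; split => //.
have cy (f : R -> R) : cont_on f y0 y2 -> sint f y0 y2 = sint f y0 y1 + sint f y1 y2.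
  move=> cf; apply/esym/(sint_chasles cf); apply/andP; split => //.
rewrite /loop (cx _ (cP y0 _)) ?(cx _ (cP y2 _)) ?(cy _ (cQ x0 _)) ?(cy _ (cQ x2 _));
  try by rewrite ?lexx ?x02 ?y02.
by ring.
Qed.

(** Among the four quarters, one carries at least a quarter of the circulation. *)
Lemma loop_bisect (x y s t : R) : 0 <= s -> 0 <= t ->
  (forall w : C, x <= w.1 <= x + s -> y <= w.2 <= y + t -> closed_at w) ->
  exists c : C, [/\ x <= c.1, c.1 + s / 2 <= x + s, y <= c.2, c.2 + t / 2 <= y + t &
    `|loop x y (x + s) (y + t)| <= 4 * `|loop c.1 c.2 (c.1 + s / 2) (c.2 + t / 2)|].
Proof.
move=> s0 t0 cl.
have xI : x <= x + s / 2 <= x + s by apply/andP; split; lra.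
have yI : y <= y + t / 2 <= y + t by apply/andP; split; lra.
have := loop_split xI yI cl.
have -> : x + s = x + s / 2 + s / 2 by lra.
have -> : y + t = y + t / 2 + t / 2 by lra.
set L := loop _ _ _ _; set A := loop _ _ _ _; set B := loop _ _ _ _.
set D := loop _ _ _ _; set E := loop _ _ _ _ => LE.
have : [\/ `|L| <= 4 * `|A|, `|L| <= 4 * `|B|, `|L| <= 4 * `|D| | `|L| <= 4 * `|E|].
  have [?|?] := leP `|L| (4 * `|A|); first by constructor 1.
  have [?|?] := leP `|L| (4 * `|B|); first by constructor 2.
  have [?|?] := leP `|L| (4 * `|D|); first by constructor 3.
  constructor 4; rewrite leNgt; apply/negP => ?.
  have := ler_normD (A + B + D) E; have := ler_normD (A + B) D; have := ler_normD A B.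
  by rewrite -LE; lra.
case=> H.
- by exists (x, y); split => //=; lra.
- by exists (x + s / 2, y); split => //=; lra.
- by exists (x, y + t / 2); split => //=; lra.
- by exists (x + s / 2, y + t / 2); split => //=; lra.
Qed.

Lemma nested_point (u v : nat -> R) : (forall n, u n <= u n.+1) ->
  (forall n, v n.+1 <= v n) -> (forall n, u n <= v n) -> exists x, forall n, u n <= x <= v n.
Proof.
move=> iu dv uv.
have um : {homo u : n m / (n <= m)%N >-> n <= m} by apply: homo_leq => //; exact: le_trans.
have vm : {homo v : n m / (n <= m)%N >-> m <= n}.
  by apply: homo_leq => // y x z /[swap]; exact: le_trans.
have uvm n m : u n <= v m.
  apply: le_trans (um _ _ (leq_maxl n m)) _.
  by apply: le_trans (uv _) _; exact: vm (leq_maxr _ _).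
exists (sup (range u)) => n; apply/andP; split.
  by apply: sup_upper_bound; [split; [exists (u 0%N), 0%N|exists (v 0%N) => _ [m _ <-]]|exists n].
by apply: sup_le_ub; [exists (u 0%N), 0%N|move=> _ [m _ <-]].
Qed.

(** Repeated bisection yields nested rectangles with a common point. The circulation loses at most a
    factor 4 per step, whereas [loop_err] at the common point makes it small compared with the
    square of the side lengths, which also loses a factor 4. *)
Lemma goursat_pos (x y s t : R) : 0 <= s -> 0 <= t ->
  (forall w : C, x <= w.1 <= x + s -> y <= w.2 <= y + t -> closed_at w) ->
  loop x y (x + s) (y + t) = 0.
Proof.
move=> s0 t0 cl; pose k n : R := 2^-1 ^+ n.
have k0 n : 0 <= k n by rewrite exprn_ge0.
have kS n : k n.+1 = k n / 2 by rewrite /k exprS mulrC.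
pose inside n (c : C) := [/\ x <= c.1, c.1 + s * k n <= x + s, y <= c.2 & c.2 + t * k n <= y + t].
(* [F] selects the corner of the next rectangle. The premise [inside] makes the choice total; it is
   discharged by induction along the sequence [c]. *)
have /choice[F FP] (nc : nat * C) : exists c : C, inside nc.1 nc.2 ->
    [/\ nc.2.1 <= c.1, c.1 + s * k nc.1.+1 <= nc.2.1 + s * k nc.1,
     nc.2.2 <= c.2, c.2 + t * k nc.1.+1 <= nc.2.2 + t * k nc.1 &
     `|loop nc.2.1 nc.2.2 (nc.2.1 + s * k nc.1) (nc.2.2 + t * k nc.1)| <=
       4 * `|loop c.1 c.2 (c.1 + s * k nc.1.+1) (c.2 + t * k nc.1.+1)|].
  case: nc => n c /=; have [[i1 i2 i3 i4]|ni] := pselect (inside n c); last by exists c.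
  have [||w w1 w2|c' H] := @loop_bisect c.1 c.2 (s * k n) (t * k n); rewrite ?mulr_ge0//.
    by apply: cl; move: w1 w2 => /andP[? ?] /andP[? ?]; apply/andP; split; lra.
  by exists c' => _; rewrite kS !mulrA.
pose fix c n : C := if n is m.+1 then F (m, c m) else (x, y).
have ins n : inside n (c n).
  elim: n => [|n IH]; first by rewrite /inside /= /k expr0 !mulr1; split.
  by have [? ? ? ? _] := FP (n, c n) IH; case: IH => ? ? ? ?; split => /=; lra.
have cS n := FP (n, c n) (ins n).
have L4 n : `|loop x y (x + s) (y + t)| <=
    4 ^+ n * `|loop (c n).1 (c n).2 ((c n).1 + s * k n) ((c n).2 + t * k n)|.
  elim: n => [|n IH]; first by rewrite expr0 mul1r /= /k expr0 !mulr1.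
  have [_ _ _ _ H] := cS n; apply: (le_trans IH).
  by rewrite exprSr -mulrA ler_wpM2l// exprn_ge0.
have [z1 z1P] : exists z1, forall n, (c n).1 <= z1 <= (c n).1 + s * k n.
  apply: nested_point => n; first by case: (cS n).
    by case: (cS n).
  by rewrite lerDl mulr_ge0.
have [z2 z2P] : exists z2, forall n, (c n).2 <= z2 <= (c n).2 + t * k n.
  apply: nested_point => n; first by case: (cS n).
    by case: (cS n).
  by rewrite lerDl mulr_ge0.
apply/eqP; rewrite -normr_eq0 eq_le normr_ge0 andbT leNgt; apply/negP => L0.
set L := `|_| in L0.
(* The tolerance will be [L / ((s + t) ^+ 2 + 1)]. As [4 ^+ n * k n ^+ 2 = 1], this leads to [L <= L
   * ((s + t) ^+ 2 / ((s + t) ^+ 2 + 1)) < L]; adding 1 to the denominator makes the inequality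
   strict. *)
have D0 : 0 < (s + t) ^+ 2 + 1 by rewrite ltr_wpDl// sqr_ge0.
have clz : closed_at (z1, z2).
  by apply: cl; [have := z1P 0%N|have := z2P 0%N]; rewrite /= /k expr0 mulr1.
have [d d0 H] := loop_err clz (divr_gt0 L0 D0).
(* Since [n < 2 ^ n], this many halvings bring the sides below [d]. *)
pose n := Num.bound ((s + t) / d).
have nd : (s + t) * k n < d.
  have : (s + t) / d < 2 ^+ n.
    apply: (lt_le_trans (archi_boundP _)); first by rewrite divr_ge0 ?addr_ge0// ltW.
    by rewrite -natrX ler_nat ltnW// ltn_expl.
  rewrite ltr_pdivrMr// => std.
  by rewrite /k exprVn ltr_pdivrMr ?exprn_gt0// mulrC.
have := H (c n).1 (c n).2 (s * k n) (t * k n).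
rewrite !mulr_ge0// -mulrDl => /(_ isT isT (z1P n) (z2P n) nd) {}H.
have {}H : `|loop (c n).1 (c n).2 ((c n).1 + s * k n) ((c n).2 + t * k n)| <=
    L / ((s + t) ^+ 2 + 1) * ((s + t) * k n) ^+ 2.
  apply: H => w w1 w2; have [? ? ? ?] := ins n.
  by apply: cl; move: w1 w2 => /andP[? ?] /andP[? ?]; apply/andP; split; lra.
have := L4 n; rewrite -/L; apply/negP; rewrite -ltNge.
apply: le_lt_trans (ler_wpM2l (exprn_ge0 n (ler0n R 4)) H) _.
have -> : 4 ^+ n * (L / ((s + t) ^+ 2 + 1) * ((s + t) * k n) ^+ 2) =
   L * ((s + t) ^+ 2 / ((s + t) ^+ 2 + 1)) * (4 ^+ n * k n ^+ 2) by ring.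
have -> : 4 ^+ n * k n ^+ 2 = 1 :> R.
  rewrite /k -exprM mulnC exprM -exprMn (_ : 4 * _ = 1) ?expr1n//.
  by field.
rewrite mulr1 gtr_pMr// ltr_pdivrMr// mul1r.
by rewrite ltrDl.
Qed.

Lemma loop_swapx x0 y0 x1 y1 : loop x1 y0 x0 y1 = - loop x0 y0 x1 y1.
Proof. by rewrite /loop (sintN _ x0 x1) (sintN _ x0 x1); ring. Qed.

Lemma loop_swapy x0 y0 x1 y1 : loop x0 y1 x1 y0 = - loop x0 y0 x1 y1.
Proof. by rewrite /loop (sintN _ y0 y1) (sintN _ y0 y1); ring. Qed.

(** Reversing one pair of bounds only changes the sign of the circulation, so the bounds may be
    assumed ordered. *)
Lemma goursat (x0 y0 x1 y1 : R) :
  (forall w : C, Num.min x0 x1 <= w.1 <= Num.max x0 x1 ->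
     Num.min y0 y1 <= w.2 <= Num.max y0 y1 -> closed_at w) ->
  loop x0 y0 x1 y1 = 0.
Proof.
wlog x01 : x0 x1 / x0 <= x1 => [H cl|].
  have [x01|/ltW x01] := leP x0 x1; first exact: H.
  by rewrite loop_swapx H ?oppr0// minC maxC.
wlog y01 : y0 y1 / y0 <= y1 => [H cl|].
  have [y01|/ltW y01] := leP y0 y1; first exact: H.
  by rewrite loop_swapy H ?oppr0// (minC y1) (maxC y1).
rewrite (min_idPl x01) (max_idPr x01) (min_idPl y01) (max_idPr y01) => cl.
have := @goursat_pos x0 y0 (x1 - x0) (y1 - y0).
by rewrite !subr_ge0 ![_ + (_ - _)]addrC !subrK; exact.
Qed.

End goursat.

(** * Primitives of closed forms on a disk, and the mean value property on circles *)

Section disk_primitive.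
Variable R : realType.
Notation C := (R * R)%type.

Lemma cabs_mono (z w : C) : `|z.1| <= `|w.1| -> `|z.2| <= `|w.2| -> cabs z <= cabs w.
Proof.
move=> h1 h2; apply: cabs_le; first exact: cabs_ge0.
rewrite sqr_cabs /cnorm2 -(real_normK (num_real z.1)) -(real_normK (num_real z.2)).
rewrite -(real_normK (num_real w.1)) -(real_normK (num_real w.2)).
by rewrite lerD// ler_pXn2r ?nnegrE.
Qed.

Lemma between_norm (a b c x : R) : Num.min b c <= x <= Num.max b c ->
  `|x - a| <= Num.max `|b - a| `|c - a|.
Proof.
rewrite ge_min le_max => /andP[h1 h2]; rewrite le_max.
have := ler_norm (b - a); have := ler_norm (c - a).
have := ler_norm (- (b - a)); have := ler_norm (- (c - a)); rewrite !normrN.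
case/orP: h1 => h1; case/orP: h2 => h2 *; have [xa|xa] := leP 0 (x - a);
  rewrite ?(ger0_norm xa) ?(ltr0_norm xa); apply/orP; (try by left; lra); by right; lra.
Qed.

(** The primitive integrates from [a] first horizontally, then vertically. Goursat's theorem allows
    the path to [z + h] to pass through [z], and continuity of [P] and [Q] at [z] controls the two
    remaining short segments. *)
Lemma closed_form_primitive (a : C) (r : R) (P Q : C -> R) :
  (forall z, disk a r z -> closed_at P Q z) ->
  exists psi : C -> R, forall z, disk a r z -> has_grad psi z (P z) (Q z).
Proof.
move=> cl.
exists (fun z => sint (fun x => P (x, a.2)) a.1 z.1 + sint (fun y => Q (z.1, y)) a.2 z.2).
move=> z zD e e0; have e20 : 0 < e / 2 by rewrite divr_gt0.
have [cP cQ] := closed_at_cont (cl z zD).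
move/cvgrPdist_le : cP => /(_ _ e20) /nbhs_cabsP[d1 d10 H1].
move/cvgrPdist_le : cQ => /(_ _ e20) /nbhs_cabsP[d2 d20 H2].
have r0 : 0 < r - cabs (z - a) by rewrite subr_gt0.
exists (Num.min (r - cabs (z - a)) (Num.min d1 d2)); first by rewrite !lt_min r0 d10 d20.
move=> h; rewrite !lt_min => /and3P[hr hd1 hd2].
(* A point whose coordinate distances to [a] are dominated by those of [z] plus those of [h] lies
   within [cabs (z - a) + cabs h] of [a]. This covers all the segments and rectangles used below. *)
have inD (w : C) : `|w.1 - a.1| <= `|z.1 - a.1| + `|h.1| ->
    `|w.2 - a.2| <= `|z.2 - a.2| + `|h.2| -> disk a r w.
  move=> w1 w2; rewrite /disk /=.
  apply: (@le_lt_trans _ _ (cabs ((`|z.1 - a.1|, `|z.2 - a.2|) + (`|h.1|, `|h.2|) : C))).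
    by apply: cabs_mono; rewrite /= [leRHS]ger0_norm ?addr_ge0.
  apply: (le_lt_trans (ler_cabsD _ _)).
  have -> : cabs (`|z.1 - a.1|, `|z.2 - a.2|) = cabs (z - a).
    by apply/le_anti/andP; split; apply: cabs_mono; rewrite /= normr_id.
  have -> : cabs (`|h.1|, `|h.2|) = cabs h.
    by apply/le_anti/andP; split; apply: cabs_mono; rewrite /= normr_id.
  by move: hr; lra.
have b1 (b c u k v : R) : Num.min b c <= u <= Num.max b c ->
   `|b - k| <= v -> `|c - k| <= v -> `|u - k| <= v.
  move=> /between_norm H bv cv; apply: (le_trans (H k)); by rewrite ge_max bv.
have nh1 : `|z.1 + h.1 - a.1| <= `|z.1 - a.1| + `|h.1|.
  by rewrite addrAC; exact: ler_normD.
have nh2 : `|z.2 + h.2 - a.2| <= `|z.2 - a.2| + `|h.2|.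
  by rewrite addrAC; exact: ler_normD.
have nz1 : `|z.1 - a.1| <= `|z.1 - a.1| + `|h.1| by rewrite lerDl.
have nz2 : `|z.2 - a.2| <= `|z.2 - a.2| + `|h.2| by rewrite lerDl.
have na1 : `|a.1 - a.1| <= `|z.1 - a.1| + `|h.1| by rewrite subrr normr0 addr_ge0.
have na2 : `|a.2 - a.2| <= `|z.2 - a.2| + `|h.2| by rewrite subrr normr0 addr_ge0.
have clD (w : C) : `|w.1 - a.1| <= `|z.1 - a.1| + `|h.1| ->
    `|w.2 - a.2| <= `|z.2 - a.2| + `|h.2| -> {for w, continuous P} /\ {for w, continuous Q}.
  by move=> w1 w2; apply: closed_at_cont; apply: cl; exact: inD.
pose M1 := `|z.1 - a.1| + `|h.1|; pose M2 := `|z.2 - a.2| + `|h.2|.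
have M1P (x : R) : `|x - a.1| <= M1 -> a.1 - M1 <= x <= a.1 + M1.
  by rewrite ler_norml => /andP[? ?]; apply/andP; split; lra.
have M2P (x : R) : `|x - a.2| <= M2 -> a.2 - M2 <= x <= a.2 + M2.
  by rewrite ler_norml => /andP[? ?]; apply/andP; split; lra.
have M1I (x : R) : a.1 - M1 <= x <= a.1 + M1 -> `|x - a.1| <= M1.
  by move=> /andP[? ?]; rewrite ler_norml; apply/andP; split; lra.
have M2I (x : R) : a.2 - M2 <= x <= a.2 + M2 -> `|x - a.2| <= M2.
  by move=> /andP[? ?]; rewrite ler_norml; apply/andP; split; lra.
have cP (y : R) : `|y - a.2| <= M2 -> cont_on (fun x => P (x, y)) (a.1 - M1) (a.1 + M1).
  by move=> yI x /M1I xI; apply: cont_row; exact: (clD (x, y) xI yI).1.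
have cQ (x : R) : `|x - a.1| <= M1 -> cont_on (fun y => Q (x, y)) (a.2 - M2) (a.2 + M2).
  by move=> xI y /M2I yI; apply: cont_col; exact: (clD (x, y) xI yI).2.
(* This rectangle trades the vertical segment above [z.1 + h.1] for the one above [z.1] followed by
   a horizontal segment at height [z.2 + h.2]. *)
have : loop P Q z.1 a.2 (z.1 + h.1) (z.2 + h.2) = 0.
  apply: goursat => w w1 w2; apply: cl; apply: inD.
    exact: b1 w1 nz1 nh1.
  exact: b1 w2 na2 nh2.
rewrite /loop => L.
have C1 := sint_chasles (cP _ na2) (M1P _ na1) (M1P _ nz1) (M1P _ nh1).
have C2 := sint_chasles (cQ _ nz1) (M2P _ na2) (M2P _ nz2) (M2P _ nh2).
have E1 : `|sint (fun x => P (x, z.2 + h.2)) z.1 (z.1 + h.1) - P z * (z.1 + h.1 - z.1)| <=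
    e / 2 * `|z.1 + h.1 - z.1|.
  apply: sint_err => x xI.
    by apply: (cP _ nh2); apply: M1P; exact: b1 xI nz1 nh1.
  have := H1 ((x, z.2 + h.2) - z); rewrite addrCA subrr addr0 distrC; apply.
  apply: le_lt_trans hd1; apply: cabs_mono => /=; last by rewrite addrAC subrr add0r.
  apply: (le_trans (between_norm _ xI)).
  by rewrite subrr normr0 addrAC subrr add0r ge_max normr_ge0 lexx.
have E2 : `|sint (fun y => Q (z.1, y)) z.2 (z.2 + h.2) - Q z * (z.2 + h.2 - z.2)| <=
    e / 2 * `|z.2 + h.2 - z.2|.
  apply: sint_err => x xI.
    by apply: (cQ _ nz1); apply: M2P; exact: b1 xI nz2 nh2.
  have := H2 ((z.1, x) - z); rewrite addrCA subrr addr0 distrC; apply.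
  apply: le_lt_trans hd2; apply: cabs_mono => /=; first by rewrite subrr normr0.
  apply: (le_trans (between_norm _ xI)).
  by rewrite subrr normr0 addrAC subrr add0r ge_max normr_ge0 lexx.
rewrite /= -C1.
move: E1 E2; rewrite ![_ + _ - z.1]addrAC ![_ + _ - z.2]addrAC !subrr !add0r => E1 E2.
have -> : sint (fun x => P (x, a.2)) a.1 z.1 +
   sint (fun x => P (x, a.2)) z.1 (z.1 + h.1) +
   sint (fun y => Q (z.1 + h.1, y)) a.2 (z.2 + h.2) -
   (sint (fun x => P (x, a.2)) a.1 z.1 + sint (fun y => Q (z.1, y)) a.2 z.2) -
   (P z * h.1 + Q z * h.2) =
   (sint (fun x => P (x, z.2 + h.2)) z.1 (z.1 + h.1) - P z * h.1) +
   (sint (fun y => Q (z.1, y)) z.2 (z.2 + h.2) - Q z * h.2).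
  by move: L; rewrite -C2; lra.
apply: (le_trans (ler_normD _ _)).
have := Re_le_cabs h; have := Im_le_cabs h.
have : e / 2 * `|h.1| <= e / 2 * cabs h by rewrite ler_wpM2l ?Re_le_cabs// ltW.
have : e / 2 * `|h.2| <= e / 2 * cabs h by rewrite ler_wpM2l ?Im_le_cabs// ltW.
by move: E1 E2; lra.
Qed.

(* On the strip [Re zeta <= 0] the function [u (a + (z - a) e^zeta)] is
   holomorphic and [2 i pi]-periodic, so by Goursat its integrals over
   vertical segments of length [2 pi] agree. *)
Lemma circle_mean (a z : C) (r : R) (u : C -> C) :
  holomorphic_on (disk a r) u -> disk a r z ->
  [/\ cont_on (fun t => (u (a + cmul (cos t, sin t) (z - a))).1) (- pi) pi,
    cont_on (fun t => (u (a + cmul (cos t, sin t) (z - a))).2) (- pi) pi &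
    sint (fun t => (u (a + cmul (cos t, sin t) (z - a))).1) (- pi) pi = 2 * pi * (u a).1].
Proof.
move=> hu zD; pose v (s : C) := a + cmul (cexp s) (z - a); pose V s := u (v s).
have vD (s : C) : s.1 <= 0 -> disk a r (v s).
  move=> s0; rewrite /disk /v /= addrAC subrr add0r cabsM.
  apply: le_lt_trans zD; rewrite ler_piMl ?cabs_ge0//.
  apply: cabs_le => //; rewrite cnorm2_cexp expr1n -[leRHS]expR0 ler_expR.
  by rewrite pmulr_rle0.
(* The form with coefficients [(V w).2] and [(V w).1] is the imaginary part of [V dzeta]; on
   vertical segments it integrates the real part of [V]. *)
have clV (s : C) : s.1 <= 0 -> closed_at (fun w => (V w).2) (fun w => (V w).1) s.
  move=> s0; have [l Hl] := holomorphic_cder hu (vD s s0).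
  have Hv : cder v s (0 + cmul (z - a) (cexp s)).
    have -> : v = fun s => a + cmul (z - a) (cexp s).
      by apply/funext => w; rewrite /v cmulC.
    by apply: cderD; [exact: cder_cst|apply: cderMl; exact: cder_cexp].
  have /cderP[H1 H2] := cder_comp Hv Hl.
  by do 3 eexists; split; [exact: H2|exact: H1].
have v0 t : V (0, t) = u (a + cmul (cos t, sin t) (z - a)).
  by rewrite /V /v /cexp /= expR0 !mul1r.
have cV (x : R) : x <= 0 -> cont_on (fun t => (V (x, t)).1) (- pi) pi.
  by move=> x0 t _; apply: (@cont_col _ (fun w => (V w).1));
    exact: (closed_at_cont (clV (x, t) x0)).2.
have -> : (fun t => (u (a + cmul (cos t, sin t) (z - a))).1) = (fun t => (V (0, t)).1).
  by apply/funext => t; rewrite v0.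
have cV2 : cont_on (fun t => (u (a + cmul (cos t, sin t) (z - a))).2) (- pi) pi.
  have -> : (fun t => (u (a + cmul (cos t, sin t) (z - a))).2) = (fun t => (V (0, t)).2).
    by apply/funext => t; rewrite v0.
  move=> t _; apply: (@cont_col _ (fun w => (V w).2)).
  exact: (closed_at_cont (clV (0, t) (lexx _))).1.
split => //; first exact: cV.
have pi0 := pi_gt0 R.
apply/eqP; rewrite -subr_eq0 -normr_eq0 eq_le normr_ge0 andbT.
apply/ler_addgt0Pr => e e0; rewrite add0r.
have e1 : 0 < e / (2 * pi) by rewrite divr_gt0// mulr_gt0.
have aD : disk a r a.
  by rewrite /disk /= subrr cabs0 (le_lt_trans _ zD)// cabs_ge0.
have [l /cderP[/has_grad_continuous ca _]] := holomorphic_cder hu aD.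
move/cvgrPdist_le : ca => /(_ _ e1) /nbhs_cabsP[d d0 H].
(* The abscissa [- N] corresponds to a circle of radius [cabs (z - a) * expR (- N)], which is less
   than [d] because [N < 1 + N <= expR N]. On it [(u _).1] is within [e / (2 * pi)] of its value at
   [a]. *)
pose N := cabs (z - a) / d.
have N0 : 0 <= N by rewrite divr_ge0 ?cabs_ge0// ltW.
have : loop (fun w => (V w).2) (fun w => (V w).1) (- N) (- pi) 0 pi = 0.
  apply: goursat => w w1 _; apply: clV.
  by move: w1; rewrite (max_idPr _) ?oppr_le0// => /andP[].
have per x : V (x, - pi) = V (x, pi).
  by rewrite /V /v /cexp /= cosN sinN sinpi oppr0.
rewrite /loop (_ : (fun x => (V (x, - pi)).2) = (fun x => (V (x, pi)).2)); last first.
  by apply/funext => x; rewrite per.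
rewrite (addrC (sint _ (- N) 0)) addrK => /eqP; rewrite subr_eq0 => /eqP ->.
have ppi : - pi <= pi :> R by lra.
have := @sint_err R (fun t => (V (- N, t)).1) (- pi) pi (u a).1 (e / (2 * pi)).
rewrite (min_idPl ppi) (max_idPr ppi).
rewrite (_ : pi - - pi = 2 * pi :> R); last by ring.
have p2 : 0 < 2 * pi :> R by rewrite mulr_gt0.
rewrite (gtr0_norm p2) (divfK (lt0r_neq0 p2)).
rewrite [(u a).1 * _]mulrC; apply; first by apply: cV; rewrite oppr_le0.
move=> t _; rewrite distrC; apply: H.
rewrite cabsM (_ : cabs _ = expR (- N)); last first.
  by rewrite /cabs cnorm2_cexp /= expRM_natl sqrtr_sqr ger0_norm// expR_ge0.
rewrite expRN mulrC ltr_pdivrMr ?expR_gt0// mulrC -ltr_pdivrMr// -/N.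
by apply: (lt_le_trans _ (expR_ge1Dx N)); rewrite ltrDr.
Qed.

End disk_primitive.

(** * Invariance of plane Lebesgue measure, area of disks, averages over rotations *)

Section plane_measure.
Variable R : realType.
Notation C := (R * R)%type.
Notation mu := (@lebesgue_measure R).
Notation mu2 := (mu \x mu)%E.

(** The pushforward of Lebesgue measure by a translation agrees with it on half-open intervals, and
    uniqueness concludes. *)
Lemma integral_shift (c : R) (f : R -> \bar R) : measurable_fun setT f ->
  (forall x, 0 <= f x)%E -> (\int[mu]_x f (x + c)%R = \int[mu]_x f x)%E.
Proof.
move=> mf f0.
pose T := measurableTypeR R.
have mc : measurable_fun (setT : set T) (fun x : T => x + c : T).
  exact: measurable_funD.
pose mphi_mixin := isMeasurableFun.Build _ _ T T (fun x : T => x + c : T) mc.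
pose phi : {mfun T >-> T} := HB.pack (fun x : T => x + c : T) mphi_mixin.
transitivity (\int[pushforward mu phi]_x f x)%E.
  by rewrite (ge0_integral_pushforward mc)//= preimage_setT.
apply: eq_measure_integral.
move=> A mA _; apply/esym/lebesgue_measure_unique => // X.
move=> /ocitvP[->|[[a b] /= ab ->]]; first by rewrite !measure0.
rewrite /pushforward (_ : _ @^-1` _ = `]a - c, b - c]%classic); last first.
  by apply/seteqP; split => x /=; rewrite !in_itv/= ltrBlDr lerBrDr.
rewrite !lebesgue_measure_itv /= !lte_fin ltrD2r ab.
by rewrite -!EFinB; congr EFin; ring.
Qed.

(** By Tonelli: on each horizontal line the shear is a translation. A constant [k] yields plane
    translations, a linear one the factors of a rotation. *)
Lemma integral_shear1 (k : R -> R) (f : C -> \bar R) : measurable_fun setT k ->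
  measurable_fun setT f -> (forall z, 0 <= f z)%E ->
  (\int[mu2]_z f (z.1 + k z.2, z.2)%R = \int[mu2]_z f z)%E.
Proof.
move=> mk mf f0; rewrite fubini_tonelli2//; last first.
  apply: measurableT_comp => //; apply: measurable_fun_pair => //.
  by apply: measurable_funD => //; exact: measurableT_comp.
rewrite fubini_tonelli2//; apply: eq_integral => y _; rewrite /fubini_G /=.
apply: (@integral_shift (k y) (fun x => f (x, y))) => //.
exact: measurable_fun_pair1.
Qed.

Lemma integral_shear2 (k : R -> R) (f : C -> \bar R) : measurable_fun setT k ->
  measurable_fun setT f -> (forall z, 0 <= f z)%E ->
  (\int[mu2]_z f (z.1, z.2 + k z.1)%R = \int[mu2]_z f z)%E.
Proof.
move=> mk mf f0; rewrite fubini_tonelli1//; last first.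
  apply: measurableT_comp => //; apply: measurable_fun_pair => //.
  by apply: measurable_funD => //; exact: measurableT_comp.
rewrite fubini_tonelli1//; apply: eq_integral => x _; rewrite /fubini_F /=.
apply: (@integral_shift (k x) (fun y => f (x, y))) => //.
exact: measurable_fun_pair2.
Qed.

Lemma measurable_shear1 (k : R -> R) : measurable_fun setT k ->
  measurable_fun setT (fun z : C => (z.1 + k z.2, z.2)).
Proof.
move=> mk; apply: measurable_fun_pair => //.
by apply: measurable_funD => //; exact: measurableT_comp.
Qed.

Lemma measurable_shear2 (k : R -> R) : measurable_fun setT k ->
  measurable_fun setT (fun z : C => (z.1, z.2 + k z.1)).
Proof.
move=> mk; apply: measurable_fun_pair => //.
by apply: measurable_funD => //; exact: measurableT_comp.
Qed.

Lemma integral_translate (a : C) (f : C -> \bar R) : measurable_fun setT f ->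
  (forall z, 0 <= f z)%E -> (\int[mu2]_z f (z + a)%R = \int[mu2]_z f z)%E.
Proof.
move=> mf f0; rewrite -[RHS](@integral_shear1 (fun=> a.1))//.
rewrite -[RHS](@integral_shear2 (fun=> a.2))//.
exact: (measurableT_comp mf (measurable_shear1 (measurable_cst _))).
Qed.

(** For the angle [theta] with cosine [c] and sine [s], the rotation is a horizontal shear, a
    vertical one of slope [s], then the same horizontal one, of slope [k = - tan (theta / 2)]. This
    slope is undefined for the half turn. *)
Lemma integral_rotation_neq (c s : R) (f : C -> \bar R) : c ^+ 2 + s ^+ 2 = 1 ->
  c != -1 -> measurable_fun setT f -> (forall z, 0 <= f z)%E ->
  (\int[mu2]_z f (cmul (c, s) z)%R = \int[mu2]_z f z)%E.
Proof.
move=> cs c1 mf f0; have c10 : 1 + c != 0 by rewrite addrC addr_eq0.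
pose k := - s / (1 + c).
have ml (t : R) : measurable_fun setT (fun y : R => t * y).
  exact: measurable_funM.
rewrite -[RHS](@integral_shear1 (fun y => k * y))//.
rewrite -[RHS](@integral_shear2 (fun x => s * x))//; last first.
  exact: (measurableT_comp mf (measurable_shear1 (ml k))).
rewrite -[RHS](@integral_shear1 (fun y => k * y))//; last first.
  exact: (measurableT_comp (measurableT_comp mf (measurable_shear1 (ml k)))
    (measurable_shear2 (ml s))).
have ck : 1 + k * s = c.
  apply: (mulIf c10).
  have -> : (1 + k * s) * (1 + c) = 1 + c - s ^+ 2 by rewrite /k; field.
  by rewrite -[s ^+ 2](addrK (c ^+ 2)) [s ^+ 2 + _]addrC cs; ring.
have sk : k * (1 + c) = - s by rewrite /k divfK.
apply: eq_integral => -[x y] _ /=; congr (f (_, _)); rewrite /cmul /= -ck.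
  transitivity ((1 + k * s) * x + (- s) * y); first by ring.
  by rewrite -sk -ck; ring.
by ring.
Qed.

Lemma measurable_cmul : measurable_fun setT (fun p : C * C => cmul p.1 p.2).
Proof.
apply: measurable_fun_pair.
  apply: measurable_funB; apply: measurable_funM;
    do ?[exact: measurableT_comp].
apply: measurable_funD; apply: measurable_funM;
    do ?[exact: measurableT_comp].
Qed.

Lemma measurable_cmull (w : C) : measurable_fun setT (cmul w : C -> C).
Proof.
apply: (@measurableT_comp _ _ _ _ _ _ (fun p : C * C => cmul p.1 p.2) _
  (fun z : C => (w, z))); first exact: measurable_cmul.
by apply: measurable_fun_pair; [exact: measurable_cst|exact: measurable_id].
Qed.

(** The half turn is the square of the quarter turn [(0, 1)]. *)
Lemma integral_rotation (c s : R) (f : C -> \bar R) : c ^+ 2 + s ^+ 2 = 1 ->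
  measurable_fun setT f -> (forall z, 0 <= f z)%E ->
  (\int[mu2]_z f (cmul (c, s) z)%R = \int[mu2]_z f z)%E.
Proof.
move=> cs mf f0; have [c1|c1] := eqVneq c (-1); last exact: integral_rotation_neq.
have s0 : s = 0 by apply/eqP; rewrite -sqrf_eq0; move: cs; rewrite c1; lra.
have q : 0 ^+ 2 + 1 ^+ 2 = 1 :> R by ring.
have n1 : 0 != -1 :> R by rewrite eq_sym oppr_eq0 oner_eq0.
rewrite -[RHS](integral_rotation_neq q)// -[RHS](integral_rotation_neq q)//.
  by apply: eq_integral => -[x y] _; congr (f (_, _)); rewrite c1 s0 /=; ring.
exact: (measurableT_comp mf (measurable_cmull _)).
Qed.

Lemma open_measurable_plane (U : set C) : open U -> measurable U.
Proof.
move=> oU.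
(* Squares with rational centre and half-side; the inclusion in [U] is part of [F], so a square that
   sticks out contributes the empty set and the union runs over a fixed countable type. *)
pose F (p : rat * rat * rat) : set C :=
  [set z | (ball (ratr p.1.1 : R) (ratr p.2) `*` ball (ratr p.1.2 : R) (ratr p.2) `<=` U)
    /\ (ball (ratr p.1.1 : R) (ratr p.2) `*` ball (ratr p.1.2 : R) (ratr p.2)) z].
rewrite (_ : U = \bigcup_p F p); last first.
  apply/seteqP; split => [z Uz|z [p _ [+ zp]]]; last exact.
  have /nbhs_ballP[e /= e0 eU] := open_nbhs_nbhs (conj oU Uz).
  have [q] := rat_in_itvoo (divr_gt0 e0 (ltr0Sn R 1)).
  rewrite in_itv/= => /andP[q0 qe].
  have zq (x : R) : x - ratr q < x + ratr q by lra.
  have [p1] := rat_in_itvoo (zq z.1).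
  rewrite in_itv/= => /andP[p1l p1r].
  have [p2] := rat_in_itvoo (zq z.2).
  rewrite in_itv/= => /andP[p2l p2r].
  exists (p1, p2, q) => //; split => [w [w1 w2]|].
    rewrite /ball /= in w1 w2.
    apply: eU; split; rewrite /ball /=.
      have := ler_distD (ratr p1) z.1 w.1.
      have : `|z.1 - ratr p1| < ratr q by rewrite ltr_norml; apply/andP; split; lra.
      by move: w1 qe; lra.
    have := ler_distD (ratr p2) z.2 w.2.
    have : `|z.2 - ratr p2| < ratr q by rewrite ltr_norml; apply/andP; split; lra.
    by move: w2 qe; lra.
  by split; rewrite /ball /= ltr_norml; apply/andP; split; lra.
apply: countable_bigcupT_measurable => //.
move=> p; have [pU|pU] := pselect (ball (ratr p.1.1 : R) (ratr p.2) `*`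
  ball (ratr p.1.2 : R) (ratr p.2) `<=` U).
  rewrite (_ : F p = ball (ratr p.1.1 : R) (ratr p.2) `*`
    ball (ratr p.1.2 : R) (ratr p.2)); last by apply/seteqP; split => [z []|].
  by apply: measurableX; exact: measurable_ball.
rewrite (_ : F p = set0)//; by apply/seteqP; split => [z []|].
Qed.

Lemma continuous_measurable_plane (U : set C) (f : C -> R) : open U ->
  (forall z, U z -> {for z, continuous f}) -> measurable_fun U f.
Proof.
move=> oU cf mU; apply: (measurability _ (RGenOpens.measurableE R)) => //.
move=> _ [_ [a [b ->] <-]]; apply: open_measurable_plane.
rewrite openE => z [Uz fz]; rewrite /interior; apply: filterI.
  exact: open_nbhs_nbhs.
apply: cf => //; apply: open_nbhs_nbhs; split => //; exact: interval_open.
Qed.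


Lemma continuous_sqrtB (r : R) :
  continuous (fun x : R => 2 * Num.sqrt (r ^+ 2 - x ^+ 2)).
Proof.
move=> x; apply: cvgM; first exact: cvg_cst.
apply: (@continuous_comp _ _ _ (fun x : R => r ^+ 2 - x ^+ 2) Num.sqrt).
  by apply: cvgB; [exact: cvg_cst|exact: exprn_continuous].
exact: sqrt_continuous.
Qed.

Lemma norm_lt_sqrt (t b : R) : (`|t| < Num.sqrt b) = (t ^+ 2 < b).
Proof.
have [b0|b0] := leP b 0; last by rewrite -sqrtr_sqr ltr_sqrt.
rewrite ler0_sqrtr// ltNge normr_ge0; apply/esym/negbTE; rewrite -leNgt.
by rewrite (le_trans b0)// sqr_ge0.
Qed.

Lemma cabs_lt (z : C) (r : R) : 0 < r -> (cabs z < r) = (cnorm2 z < r ^+ 2).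
Proof.
move=> r0; rewrite -sqr_cabs ltr_pXn2r ?nnegrE ?cabs_ge0//.
exact: ltW.
Qed.

(** Substitute [x = r sin t]; the resulting integrand has the primitive [G] below. *)
Lemma integral_sqrtB (r : R) : 0 < r ->
  (\int[mu]_(x in `[(- r)%R, r]) (2 * Num.sqrt (r ^+ 2 - x ^+ 2))%:E = (pi * r ^+ 2)%:E)%E.
Proof.
move=> r0; pose F (t : R) := r * sin t.
have pi0 := pi_gt0 R.
have ph : - (pi / 2) < pi / 2 :> R by lra.
have dF (t : R) : is_derive t 1 F (r * cos t).
  by apply: is_derive_eq; rewrite /GRing.scale /=; ring.
have F' : derive1 F = (fun t => r * cos t).
  by apply/funext => t; rewrite derive1E; exact: derive_val.
have cF' : continuous (fun t : R => r * cos t).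
  by move=> t; apply: cvgM; [exact: cvg_cst|exact: continuous_cos].
have cF : continuous F.
  by move=> t; apply: cvgM; [exact: cvg_cst|exact: continuous_sin].
have -> : - r = F (- (pi / 2)) by rewrite /F sinN sin_pihalf mulrN mulr1.
have -> : (`[F (- (pi / 2)), r] = `[F (- (pi / 2)), F (pi / 2)])%classic.
  by have -> : F (pi / 2) = r by rewrite /F sin_pihalf mulr1.
rewrite (@integration_by_substitution_increasing _ F); last first.
- exact/continuous_subspaceT/continuous_sqrtB.
- split => [x _||]; first exact: ex_derive.
  + exact/cvg_at_right_filter/cF.
  + exact/cvg_at_left_filter/cF.
- by rewrite F'; apply/cvg_ex; eexists; apply/cvg_at_left_filter/cF'.
- by rewrite F'; apply/cvg_ex; eexists; apply/cvg_at_right_filter/cF'.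
- by rewrite F' => t _; exact: cF'.
- by move=> x y xI yI xy; rewrite /F ltr_pM2l// ltr_sin.
- exact: ltW.
pose G (t : R) := r ^+ 2 * (t + sin t * cos t).
have dG (t : R) : is_derive t 1 G (2 * r ^+ 2 * cos t ^+ 2).
  apply: is_derive_eq; rewrite /GRing.scale /=.
  by rewrite mulrN -!expr2 sin2cos2; ring.
have cG : continuous G.
  move=> t; apply: differentiable_continuous; apply/derivable1_diffP.
  exact: ex_derive.
transitivity (\int[mu]_(t in `[(- (pi / 2))%R, (pi / 2)%R])
    (2 * r ^+ 2 * cos t ^+ 2)%:E)%E.
  apply: eq_integral => t; rewrite inE /= in_itv /= => tI; congr EFin.
  rewrite F' /= !fctE /=.
  have -> : r ^+ 2 - F t ^+ 2 = (r * cos t) ^+ 2.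
    by rewrite /F !exprMn cos2sin2; ring.
  rewrite sqrtr_sqr ger0_norm; first by ring.
  by rewrite mulr_ge0// ?cos_ge0_pihalf// ltW.
rewrite (@continuous_FTC2 _ _ G)//.
- rewrite -EFinB; congr EFin; rewrite /G sinN cosN cos_pihalf.
  by field.
- apply: continuous_subspaceT => t; apply: cvgM; first exact: cvg_cst.
  by apply: (@continuous_comp _ _ _ cos (fun x => x ^+ 2));
    [exact: continuous_cos|exact: exprn_continuous].
- split => [x _||]; first exact: ex_derive.
  + exact/cvg_at_right_filter/cG.
  + exact/cvg_at_left_filter/cG.
- by move=> t _; rewrite derive1E; exact: derive_val.
Qed.

(** Vertical sections are intervals of half-length [q]. As [Num.sqrt] vanishes on negative numbers,
    the formula is also right for the empty sections. *)
Lemma measure_disk (a : C) (r : R) : 0 < r -> mu2 (disk a r) = (pi * r ^+ 2)%:E.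
Proof.
move=> r0.
have dx x : mu (xsection (disk a r) x) =
    (2 * Num.sqrt (r ^+ 2 - (x - a.1) ^+ 2))%:E.
  pose q := Num.sqrt (r ^+ 2 - (x - a.1) ^+ 2).
  have q0 : 0 <= q by exact: sqrtr_ge0.
  have -> : xsection (disk a r) x = `]a.2 - q, a.2 + q[%classic.
    rewrite /xsection; apply/funext => y; apply/propext => /=.
    rewrite in_setE /= in_itv /= -ltr_distl norm_lt_sqrt /disk /= cabs_lt//.
    by rewrite /cnorm2 /= ltrBrDl.
  rewrite lebesgue_measure_itv/= lte_fin -/q.
  case: ifPn => [|nq]; first by rewrite -EFinB => _; congr EFin; ring.
  by congr EFin; move: nq; rewrite -leNgt; lra.
transitivity (\int[mu]_x (2 * Num.sqrt (r ^+ 2 - (x - a.1) ^+ 2))%:E)%E.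
  by apply: eq_integral => x _; exact: dx.
rewrite (@integral_shift (- a.1) (fun x => (2 * Num.sqrt (r ^+ 2 - x ^+ 2))%:E)); last 2 first.
- by apply/measurable_EFinP; apply: continuous_measurable_fun; exact: continuous_sqrtB.
- by move=> x; rewrite lee_fin mulr_ge0// sqrtr_ge0.
rewrite -integral_sqrtB// [RHS]integral_mkcond; apply: eq_integral => x _.
rewrite patchE; case: ifPn => //; rewrite notin_setE /= in_itv /= -ler_norml.
move=> /negP; rewrite -ltNge => xr.
rewrite ler0_sqrtr ?mulr0// subr_le0 -[x ^+ 2]real_normK ?num_real//.
by rewrite ler_pXn2r ?nnegrE// ltW.
Qed.

(** Needed to use the plane measure as a factor in Tonelli's theorem in [rotation_average]. *)
Lemma sigma_finite_plane : sigma_finite setT mu2.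
Proof.
exists (fun n => disk 0 n.+1%:R); last first.
  move=> n; split; first by apply: open_measurable_plane; exact: open_disk.
  by rewrite measure_disk// ltry.
apply/esym; rewrite -subTset => z _; exists (Num.bound (cabs z)) => //=.
rewrite /disk /= subr0 (lt_trans (archi_boundP (cabs_ge0 z)))//.
by rewrite ltr_nat.
Qed.

(** Exchange the two integrals; for each angle [t] the inner one is the integral of [G], by rotation
    invariance. *)
Lemma rotation_average (G : C -> \bar R) : measurable_fun setT G ->
  (forall z, 0 <= G z)%E ->
  (\int[mu2]_z \int[mu]_(t in `[(- pi)%R, pi%R]) G (cmul (cos t, sin t) z)%R =
   (2 * pi)%:E * \int[mu2]_z G z)%E.
Proof.
move=> mG G0.
pose I := `[- pi, pi]%classic : set R.
pose K (p : R * C) := ((fun q : R * C => G (cmul (cos q.1, sin q.1) q.2)) \_ (I `*` setT)) p.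
have mrot : measurable_fun setT (fun q : R * C => G (cmul (cos q.1, sin q.1) q.2)).
  apply: measurableT_comp => //.
  apply: (@measurableT_comp _ _ _ _ _ _ (fun p : C * C => cmul p.1 p.2) _
    (fun q : R * C => ((cos q.1, sin q.1), q.2))); first exact: measurable_cmul.
  apply: measurable_fun_pair => //; apply: measurable_fun_pair.
    by apply: measurableT_comp => //; apply: continuous_measurable_fun; exact: continuous_cos.
  by apply: measurableT_comp => //; apply: continuous_measurable_fun; exact: continuous_sin.
have mK : measurable_fun setT K.
  apply/(measurable_restrictT _ _).1; last exact: measurable_funTS.
  by apply: measurableX => //; exact: measurable_itv.
have K0 p : (0 <= K p)%E by rewrite /K patchE; case: ifPn.
transitivity (\int[mu2]_z \int[mu]_t K (t, z))%E.
  apply: eq_integral => z _; rewrite integral_mkcond; apply: eq_integral => t _.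
  rewrite /K !patchE /=.
  by rewrite (_ : (t \in _) = ((t, z) \in I `*` setT))//; apply/idP/idP; rewrite !inE //= => -[].
pose T := measurableTypeR R.
pose sf := Measure_isSigmaFinite.Build _ _ _ mu2 sigma_finite_plane.
pose m2 : {sigma_finite_measure set (T * T)%type -> \bar R} := HB.pack mu2 sf.
rewrite -(@fubini_tonelli _ _ _ _ _ mu m2 K)//.
transitivity (\int[mu]_(t in I) \int[mu2]_z G z)%E.
  rewrite [RHS]integral_mkcond; apply: eq_integral => t _; rewrite patchE.
  case: ifPn => tI.
    rewrite -(@integral_rotation (cos t) (sin t))//; last exact: cos2Dsin2.
    apply: eq_integral => z _; rewrite /K patchE ifT// inE; split => //.
    by rewrite inE in tI.
  apply: integral0_eq => z _; rewrite /K patchE ifF//.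
  by apply/negbTE; apply: contra tI; rewrite !inE => -[].
have mI : mu I = (2 * pi)%:E.
  rewrite lebesgue_measure_itv /= lte_fin ifT; last by rewrite gtrN ?pi_gt0.
  by rewrite -EFinB; congr EFin; ring.
rewrite integral_cst; last exact: measurable_itv.
by rewrite muleC; congr (_ * _)%E.
Qed.

End plane_measure.

(** * Integrals over disks and orthogonality for radial weights *)

Section disk_integrals.
Variable R : realType.
Notation C := (R * R)%type.
Notation mu := (@lebesgue_measure R).
Notation mu2 := (mu \x mu)%E.
Implicit Types (a z : C) (r k : R) (u f : C -> C).

Lemma measurable_disk a r : measurable (disk a r).
Proof. by apply: open_measurable_plane; exact: open_disk. Qed.

Lemma cder_continuous u z l : cder u z l ->
  {for z, continuous (fun w => (u w).1)} /\ {for z, continuous (fun w => (u w).2)}.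
Proof. by move=> /cderP[/has_grad_continuous ? /has_grad_continuous]. Qed.

Lemma cder_continuous_cnorm2 u z l : cder u z l ->
  {for z, continuous (fun w => cnorm2 (u w))}.
Proof.
move=> /cder_continuous[c1 c2].
by apply: cvgD; apply: cvgM.
Qed.

Lemma measurable_weighted (D : set C) u (q : C -> R) : open D -> holomorphic_on D u ->
  (forall z, D z -> {for z, continuous q}) ->
  measurable_fun D (fun z => (cnorm2 (u z) * expR (q z))%:E).
Proof.
move=> oD hu cq; apply/measurable_EFinP; apply: continuous_measurable_plane => // z Dz.
have [l Hl] := holomorphic_cder hu Dz.
apply: cvgM; first exact: cder_continuous_cnorm2 Hl.
by apply: (@continuous_comp _ _ _ q expR); [exact: cq|exact: continuous_expR].
Qed.

Lemma holomorphic_cst (D : set C) (c : C) : holomorphic_on D (fun=> c).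
Proof. by apply: cder_holomorphic => z _; exists 0; exact: cder_cst. Qed.

Lemma holomorphicD (D : set C) u v : holomorphic_on D u -> holomorphic_on D v ->
  holomorphic_on D (fun z => u z + v z).
Proof.
move=> hu hv; apply: cder_holomorphic => z Dz.
have [l Hl] := holomorphic_cder hu Dz; have [m Hm] := holomorphic_cder hv Dz.
by exists (l + m); exact: cderD.
Qed.

Lemma holomorphicM (D : set C) u v : holomorphic_on D u -> holomorphic_on D v ->
  holomorphic_on D (fun z => cmul (u z) (v z)).
Proof.
move=> hu hv; apply: cder_holomorphic => z Dz.
have [l Hl] := holomorphic_cder hu Dz; have [m Hm] := holomorphic_cder hv Dz.
exact: cderM Hl Hm.
Qed.

Lemma holomorphic_cexp (D : set C) u : holomorphic_on D u ->
  holomorphic_on D (fun z => cexp (u z)).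
Proof.
move=> hu; apply: cder_holomorphic => z Dz.
have [l Hl] := holomorphic_cder hu Dz.
by exists (cmul (cexp (u z)) l); exact: (cder_comp Hl (cder_cexp _)).
Qed.

(** This links disk integrals to circle means without polar coordinates: extend [g] by zero, move
    the centre to the origin and average over rotations, which preserve the disk. *)
Lemma disk_average a r (g : C -> R) : measurable_fun (disk a r) (EFin \o g) ->
  (forall z, disk a r z -> 0 <= g z) ->
  ((2 * pi)%:E * \int[mu2]_(z in disk a r) (g z)%:E =
   \int[mu2]_(z in disk 0%R r) \int[mu]_(t in `[(- pi)%R, pi%R])
     (g (a + cmul (cos t, sin t) z)%R)%:E)%E.
Proof.
move=> mg g0; pose G0 := (EFin \o g) \_ (disk a r); pose G z := G0 (z + a).
have mG0 : measurable_fun setT G0.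
  by apply/(measurable_restrictT _ _).1 => //; exact: measurable_disk.
have G00 z : (0 <= G0 z)%E.
  by rewrite /G0 patchE; case: ifPn => //; rewrite inE => /g0; rewrite lee_fin.
have mG : measurable_fun setT G.
  apply: (measurableT_comp mG0); apply: measurable_fun_pair => /=; exact: measurable_funD.
rewrite [X in (_ * X)%E]integral_mkcond -/G0 -(integral_translate a)//.
transitivity ((2 * pi)%:E * \int[mu2]_z G z)%E; first by [].
rewrite -(rotation_average mG (fun z => G00 (z + a))) [RHS]integral_mkcond.
apply: eq_integral => z _; rewrite patchE.
have rz t : cabs (cmul (cos t, sin t) z) = cabs z.
  by rewrite cabsM {1}/cabs /cnorm2 /= cos2Dsin2 sqrtr1 mul1r.
case: ifPn => [|]; rewrite (inE,notin_setE) /disk /= subr0 => zr.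
  apply: eq_integral => t _; rewrite /G /G0 patchE ifT /=; first by rewrite addrC.
  by rewrite inE /disk /= addrK rz.
apply: integral0_eq => t _; rewrite /G /G0 patchE ifF//.
by apply/negbTE; rewrite notin_setE /disk /= addrK rz.
Qed.

Lemma integral_EFin_Rintegral (g : R -> R) (l m : R) : cont_on g l m -> l <= m ->
  (\int[mu]_(x in `[l, m]) (g x)%:E = (sint g l m)%:E)%E.
Proof.
move=> cg lm; rewrite /sint lm /Rintegral fineK//.
by apply: (integrable_fin_num _ (cont_on_integrable cg)); exact: measurable_itv.
Qed.

Lemma sint_cst (c l m : R) : sint (fun=> c) l m = c * (m - l).
Proof.
apply/eqP; rewrite -subr_eq0 -normr_le0 -(mul0r `|m - l|).
by apply: sint_err => t _; [exact: cvg_cst|rewrite subrr normr0].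
Qed.

(* [|u|^2 - 1 - |u - 1|^2 = 2 Re (u - 1)] has mean zero on every circle centred at [a]. *)
Lemma radial_pythagoras a r k u : 0 < r -> holomorphic_on (disk a r) u -> u a = (1, 0) ->
  (\int[mu2]_(z in disk a r) (cnorm2 (u z) * expR (k * cnorm2 (z - a)%R))%:E =
   \int[mu2]_(z in disk a r) (expR (k * cnorm2 (z - a)%R))%:E +
   \int[mu2]_(z in disk a r) (cnorm2 (u z - (1, 0))%R * expR (k * cnorm2 (z - a)%R))%:E)%E.
Proof.
move=> r0 hu ua.
have hu1 : holomorphic_on (disk a r) (fun z => u z - (1, 0)).
  by apply: holomorphicD => //; exact: holomorphic_cst.
have oD := @open_disk R a r.
have cr z : disk a r z -> {for z, continuous (fun w : C => k * cnorm2 (w - a))}.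
  move=> _; apply: cvgM; first exact: cvg_cst.
  exact: (cder_continuous_cnorm2 (cder_shift a z)).
have mu1 := measurable_weighted oD hu cr.
have mu12 := measurable_weighted oD hu1 cr.
have mw : measurable_fun (disk a r) (fun z => (expR (k * cnorm2 (z - a)))%:E).
  have := measurable_weighted oD (holomorphic_cst (D := disk a r) (1, 0)) cr.
  by congr measurable_fun; apply/funext => z; rewrite /cnorm2 /= expr1n expr0n /= addr0 mul1r.
rewrite -ge0_integralD//; last first.
- by move=> z _; rewrite lee_fin mulr_ge0 ?cnorm2_ge0 ?expR_ge0.
- exact: measurable_disk.
pose g1 z := cnorm2 (u z) * expR (k * cnorm2 (z - a)).
pose g2 z := expR (k * cnorm2 (z - a)) + cnorm2 (u z - (1, 0)) * expR (k * cnorm2 (z - a)).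
have p2 : 0 < 2 * pi :> R by rewrite mulr_gt0 ?pi_gt0.
have cancel (x y : \bar R) : ((2 * pi)%:E * x = (2 * pi)%:E * y)%E -> x = y.
  move=> /(congr1 (mule ((2 * pi)^-1)%:E)).
  by rewrite !muleA -EFinM mulVf ?gt_eqF// !mul1e.
apply: cancel.
rewrite (@disk_average a r g1)//; last first.
  by move=> z _; rewrite mulr_ge0 ?cnorm2_ge0 ?expR_ge0.
rewrite (@disk_average a r g2)//; last 2 first.
- exact: (emeasurable_funD mw mu12).
- by move=> z _; rewrite addr_ge0 ?mulr_ge0 ?cnorm2_ge0 ?expR_ge0.
apply: eq_integral => z; rewrite inE /disk /= subr0 => zr.
have zD : disk a r (z + a) by rewrite /disk /= addrK.
have := circle_mean hu zD; rewrite addrK ua /= mulr1.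
set U := fun t => (u _).1; set V := fun t => (u _).2 => -[cU cV sU].
pose W := expR (k * cnorm2 z).
have wt t : expR (k * cnorm2 (a + cmul (cos t, sin t) z - a)) = W.
  by rewrite addrAC subrr add0r cnorm2M {1}/cnorm2 /= cos2Dsin2 mul1r.
have ppi : - pi <= pi :> R by have := pi_gt0 R; lra.
(* The radial weight has the constant value [W] on the circle, and [|u|^2 W = A + B], where [A] is
   the integrand of the right-hand side and [B = 2 W Re (u - 1)] has integral zero by
   [circle_mean]. *)
pose A t := W + ((U t - 1) ^+ 2 + V t ^+ 2) * W.
pose B t := 2 * W * (U t - 1).
have cA : cont_on A (- pi) pi.
  move=> t tI; apply: cvgD; first exact: cvg_cst.
  apply: cvgM; last exact: cvg_cst.
  apply: cvgD; apply: cvgM; do ?exact: cV;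
  by apply: cvgB; [exact: cU|exact: cvg_cst].
have cB : cont_on B (- pi) pi.
  move=> t tI; apply: cvgM; first exact: cvg_cst.
  by apply: cvgB; [exact: cU|exact: cvg_cst].
transitivity (\int[mu]_(t in `[(- pi)%R, pi]) ((A t)%:E + (B t)%:E))%E.
  apply: eq_integral => t _; rewrite /g1 wt -EFinD; congr EFin.
  by rewrite /A /B /cnorm2 -/(U t) -/(V t); ring.
rewrite (integralD _ (cont_on_integrable cA) (cont_on_integrable cB)); last exact: measurable_itv.
rewrite [X in (_ + X)%E](integral_EFin_Rintegral cB)//.
have -> : sint B (- pi) pi = 0.
  rewrite /B /sint ppi RintegralZl//; last first.
    by apply: cont_on_integrable => t tI; apply: cvgB; [exact: cU|exact: cvg_cst].
  rewrite -[X in _ * X]/(\int[mu]_(x in `[- pi, pi]) (U x - 1)).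
  have := sintB ppi cU (_ : cont_on (fun=> 1) (- pi) pi).
  rewrite {1}/sint ppi => ->; last by move=> t _; exact: cvg_cst.
  by rewrite sU sint_cst; ring.
rewrite adde0; apply: eq_integral => t _; rewrite /g2 wt; congr EFin.
by rewrite /A /cnorm2 /= -/(U t) -/(V t) subr0.
Qed.

Lemma integral_disk_cst a r (m : R) : 0 < r ->
  (\int[mu2]_(z in disk a r) m%:E = (m * (pi * r ^+ 2))%:E)%E.
Proof.
move=> r0; have := @integral_cst _ _ _ mu2 _ (measurable_disk a r) m%:E.
by move=> ->; rewrite EFinM; congr (_ * _)%E; exact: measure_disk.
Qed.

(** Source of all strictly positive lower bounds: keep only a smaller disk on which [g] is at least
    [m]. *)
Lemma integral_disk_ge a r b (s m : R) (g : C -> R) : 0 < s -> 0 <= m ->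
  disk b s `<=` disk a r -> measurable_fun (disk a r) (EFin \o g) ->
  (forall z, disk a r z -> 0 <= g z) -> (forall z, disk b s z -> m <= g z) ->
  ((m * (pi * s ^+ 2))%:E <= \int[mu2]_(z in disk a r) (g z)%:E)%E.
Proof.
move=> s0 m0 ba mg g0 gm; rewrite -(integral_disk_cst b)//.
apply: (@le_trans _ _ (\int[mu2]_(z in disk b s) (g z)%:E)%E).
  apply: ge0_le_integral => //; first exact: measurable_disk.
  by apply: measurable_funS mg => //; exact: measurable_disk.
apply: ge0_subset_integral => //; exact: measurable_disk.
Qed.

End disk_integrals.

(** * Taylor's formula and the holomorphic function [H] whose real part absorbs [phi] *)

Section gauges.
Variable R : realType.
Notation C := (R * R)%type.
Implicit Types (a z h : C) (r : R) (H : C -> C).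

Lemma has_grad_affine (g : C -> R) z (p q c d : R) : has_grad g z p q ->
  has_grad (fun w => c * (g w - d)) z (c * p) (c * q).
Proof.
move=> Hg e e0; have c0 : 0 < `|c| + 1 by rewrite ltr_wpDl.
have [t t0 Ht] := Hg _ (divr_gt0 e0 c0); exists t => // h /Ht {}Ht.
rewrite (_ : _ - _ = c * (g (z + h) - g z - (p * h.1 + q * h.2))); last by ring.
rewrite normrM; apply: le_trans (_ : (`|c| + 1) * (e / (`|c| + 1) * cabs h) <= _).
  by apply: ler_pM => //; rewrite lerDl.
by rewrite mulrA mulrC [_ * (e / _)]mulrC divfK ?lt0r_neq0// mulrC.
Qed.

Lemma err_is_derive (f : R -> R) (x l : R) :
  (forall e : R, 0 < e -> exists2 d : R, 0 < d &
    forall k : R, `|k| < d -> `|f (x + k) - f x - l * k| <= e * `|k|) ->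
  is_derive x 1 f l.
Proof.
move=> H.
have cl : h^-1 *: ((f \o shift x) (h *: 1) - f x) @[h --> 0^'] --> l.
  apply/cvgrPdist_le => e e0; have [d d0 {}H] := H e e0.
  apply/nbhs_ballP; exists d => //= k; rewrite /ball /= sub0r normrN => kd k0.
  rewrite [k%:A]mulr1 /GRing.scale /= (addrC k x).
  have k00 : 0 < `|k| by rewrite normr_gt0.
  rewrite distrC -(ler_pM2r k00) -normrM.
  rewrite (_ : _ * k = f (x + k) - f x - l * k); first exact: H.
  by rewrite mulrBl mulrAC mulVf ?mul1r.
by apply: DeriveDef; [apply: cvgP cl|apply: cvg_lim].
Qed.

Lemma has_grad_line (g : C -> R) a h (t p q : R) : has_grad g (a + t *: h) p q ->
  is_derive t 1 (fun t => g (a + t *: h)) (p * h.1 + q * h.2).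
Proof.
move=> Hg; apply: err_is_derive => e e0.
have c0 : 0 < cabs h + 1 by rewrite ltr_wpDl ?cabs_ge0.
have [d d0 H] := Hg _ (divr_gt0 e0 c0).
exists (d / (cabs h + 1)); first by rewrite divr_gt0.
move=> k; rewrite ltr_pdivlMr// => kd.
have ck : cabs (k *: h) = `|k| * cabs h.
  rewrite /cabs /cnorm2 /= /GRing.scale /= !exprMn -mulrDr sqrtrM ?sqr_ge0//.
  by rewrite sqrtr_sqr.
have := H (k *: h).
rewrite ck (_ : a + t *: h + k *: h = a + (t + k) *: h); last by rewrite scalerDl addrA.
move=> H1.
have {}H1 : `|g (a + (t + k) *: h) - g (a + t *: h) - (p * (k *: h).1 + q * (k *: h).2)| <=
     e / (cabs h + 1) * (`|k| * cabs h).
  by apply: H1; apply: le_lt_trans kd; rewrite ler_wpM2l// lerDl.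
rewrite (_ : (p * h.1 + q * h.2) * k = p * (k *: h).1 + q * (k *: h).2); last first.
  by rewrite /= /GRing.scale /=; ring.
apply: (le_trans H1); rewrite -mulrA; apply: ler_wpM2l; first exact: ltW.
by rewrite ler_pdivrMl// mulrC ler_wpM2r// lerDl.
Qed.

(** One application of the mean value theorem along the segment from [a] to [a + h], combined with
    differentiability at [a] of the two first partial derivatives. The mixed derivatives enter
    through their sum. *)
Lemma taylor2 (O : set C) (phi : C -> R) a (e : R) : open O -> smooth_on O phi -> O a ->
  0 < e -> exists2 d : R, 0 < d & forall h, cabs h < d ->
    `|phi (a + h) - phi a - (Defs.iterD [:: (1, 0)] phi a * h.1 + Defs.iterD [:: (0, 1)] phi a * h.2
      + (Defs.iterD [:: (1, 0); (1, 0)] phi a * h.1 ^+ 2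
        + (Defs.iterD [:: (0, 1); (1, 0)] phi a + Defs.iterD [:: (1, 0); (0, 1)] phi a)
          * (h.1 * h.2)
        + Defs.iterD [:: (0, 1); (0, 1)] phi a * h.2 ^+ 2) / 2)| <= e * cnorm2 h.
Proof.
move=> oO sm Oa e0; have e20 : 0 < e / 2 by rewrite divr_gt0.
have /nbhs_cabsP[d0 d00 H0] := open_nbhs_nbhs (conj oO Oa).
have [d1 d10 H1] := differentiable_has_grad (sm [:: (1, 0)] a Oa) e20.
have [d2 d20 H2] := differentiable_has_grad (sm [:: (0, 1)] a Oa) e20.
exists (Num.min d0 (Num.min d1 d2)); first by rewrite !lt_min d00 d10 d20.
move=> h; rewrite !lt_min => /and3P[hd0 hd1 hd2].
set A := Defs.iterD [:: (1, 0)] phi a; set B := Defs.iterD [:: (0, 1)] phi a.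
set X := Defs.iterD [:: (1, 0); (1, 0)] phi a; set Y := Defs.iterD [:: (0, 1); (0, 1)] phi a.
set M := Defs.iterD [:: (0, 1); (1, 0)] phi a; set N := Defs.iterD [:: (1, 0); (0, 1)] phi a.
have {}H1 k : cabs k < d1 -> `|Defs.iterD [:: (1, 0)] phi (a + k) - A -
    (X * k.1 + M * k.2)| <= e / 2 * cabs k := H1 k.
have {}H2 k : cabs k < d2 -> `|Defs.iterD [:: (0, 1)] phi (a + k) - B -
    (N * k.1 + Y * k.2)| <= e / 2 * cabs k := H2 k.
clearbody A B X Y M N.
have ck (t : R) : 0 <= t <= 1 -> cabs (t *: h) <= cabs h.
  move=> /andP[t0 t1]; rewrite /cabs /cnorm2 /= /GRing.scale /= !exprMn -mulrDr.
  by rewrite sqrtrM ?sqr_ge0// sqrtr_sqr ger0_norm// ler_piMl// sqrtr_ge0.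
(* Subtracting the Taylor polynomial along the segment makes [g 1 - g 0] the remainder, while [dg]
   only contains first-order errors of the partial derivatives. *)
pose g (t : R) := phi (a + t *: h) - ((A * h.1 + B * h.2) * t +
  (X * h.1 ^+ 2 + (M + N) * (h.1 * h.2) + Y * h.2 ^+ 2) / 2 * t ^+ 2).
pose dg (t : R) := Defs.iterD [:: (1, 0)] phi (a + t *: h) * h.1 +
  Defs.iterD [:: (0, 1)] phi (a + t *: h) * h.2 - ((A * h.1 + B * h.2) +
  (X * h.1 ^+ 2 + (M + N) * (h.1 * h.2) + Y * h.2 ^+ 2) * t).
have Dg (t : R) : 0 <= t <= 1 -> is_derive t 1 g (dg t).
  move=> t01.
  have Ot : O (a + t *: h) by apply: H0; apply: le_lt_trans hd0; exact: ck.
  have Hl := has_grad_line (differentiable_has_grad (sm [::] _ Ot)).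
  apply: is_derive_eq; rewrite /dg /GRing.scale /=.
  by field.
have D01 (t : R) : t \in `]0, 1[ -> is_derive t 1 g (dg t).
  by rewrite in_itv/= => /andP[? ?]; apply: Dg; rewrite !ltW.
have cg : {within `[0, 1], continuous g}.
  apply: continuous_in_subspaceT => t; rewrite inE /= in_itv /= => t01.
  apply: differentiable_continuous; apply/derivable1_diffP.
  by have := Dg t t01; case.
have [c] := MVT ltr01 D01 cg; rewrite in_itv /= => /andP[c0 c1].
have c01 : 0 <= c <= 1 by rewrite !ltW.
rewrite subr0 mulr1 {1 2}/g scale1r scale0r addr0 expr0n /= expr1n !mulr0 !mulr1 addr0 subr0 => E.
have -> : forall w, phi (a + h) - phi a - w = phi (a + h) - w - phi a by move=> w; ring.
rewrite E.
have := H1 (c *: h) (le_lt_trans (ck c c01) hd1).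
have := H2 (c *: h) (le_lt_trans (ck c c01) hd2).
rewrite /dg; set B1 := Defs.iterD _ _ _; set A1 := Defs.iterD _ _ _ => K2 K1.
have cl (x : R) : `|x| <= e / 2 * cabs (c *: h) -> forall y : R, `|y| <= cabs h ->
    `|x * y| <= e / 2 * cnorm2 h.
  move=> xe y yh; rewrite normrM -sqr_cabs expr2 mulrA; apply: ler_pM => //.
  by apply: (le_trans xe); rewrite ler_wpM2l ?ck// ltW.
have E1 := cl _ K1 _ (Re_le_cabs h); have E2 := cl _ K2 _ (Im_le_cabs h).
clearbody A1 B1.
rewrite (_ : _ - _ = (A1 - A - (X * (c *: h).1 + M * (c *: h).2)) * h.1 +
  (B1 - B - (N * (c *: h).1 + Y * (c *: h).2)) * h.2); last first.
  have -> : (c *: h).1 = c * h.1 by [].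
  have -> : (c *: h).2 = c * h.2 by [].
  by ring.
by apply: (le_trans (ler_normD _ _)); move: E1 E2; lra.
Qed.

(** In the quadratic form, [X x^2 + Y y^2] is [(X - Y) / 2] times [x^2 - y^2] plus [(X + Y) / 2]
    times [x^2 + y^2]. The first term, the mixed term and the linear part are real parts of complex
    polynomials and go into [H]; the last leaves the Laplacian. *)
Lemma taylor_gauge (O : set C) (phi : C -> R) a : open O -> smooth_on O phi -> O a ->
  exists H, [/\ forall D, holomorphic_on D H, H a = 0 & forall e : R, 0 < e ->
    exists2 d : R, 0 < d & forall z, disk a d z ->
    `|phi z - phi a - 2 * (H z).1 - laplacian phi a / 4 * cnorm2 (z - a)|
      <= e * cnorm2 (z - a)].
Proof.
move=> oO sm Oa.
set A := Defs.iterD [:: (1, 0)] phi a; set B := Defs.iterD [:: (0, 1)] phi a.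
set X := Defs.iterD [:: (1, 0); (1, 0)] phi a; set Y := Defs.iterD [:: (0, 1); (0, 1)] phi a.
set M := Defs.iterD [:: (0, 1); (1, 0)] phi a; set N := Defs.iterD [:: (1, 0); (0, 1)] phi a.
exists (fun z => cmul (A / 2, - B / 2) (z - a) +
  cmul ((X - Y) / 8, - (M + N) / 8) (cmul (z - a) (z - a))); split.
- move=> D; apply: cder_holomorphic => z _; eexists; apply: cderD.
    exact: (cderMl _ (cder_shift a z)).
  exact: (cderMl _ (cder_comp (cder_shift a z) (cder_sqr _))).
- by rewrite subrr !cmul0 addr0.
move=> e e0; have [d d0 H] := taylor2 oO sm Oa e0; exists d => // z zd.
have := H _ zd; rewrite addrCA subrr addr0 -/A -/B -/X -/Y -/M -/N.
congr (`|_| <= _); rewrite /laplacian -/X -/Y /cnorm2 /cmul /=.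
by field.
Qed.

(** The harmonic conjugate [psi] is a primitive of [- phi_y dx + phi_x dy], which is closed exactly
    because [phi_xx = - phi_yy]. *)
Lemma harmonic_gauge (O : set C) (phi : C -> R) a r : smooth_on O phi ->
  disk a r `<=` O -> (forall z, disk a r z -> laplacian phi z = 0) ->
  exists H, [/\ holomorphic_on (disk a r) H, H a = 0 &
    forall z, disk a r z -> 2 * (H z).1 = phi z - phi a].
Proof.
move=> sm dO lap.
have gx z : disk a r z -> has_grad (Defs.iterD [:: (1, 0)] phi) z
    (Defs.iterD [:: (1, 0); (1, 0)] phi z) (Defs.iterD [:: (0, 1); (1, 0)] phi z).
  by move=> /dO Oz; exact: differentiable_has_grad (sm [:: (1, 0)] z Oz).
have gy z : disk a r z -> has_grad (Defs.iterD [:: (0, 1)] phi) z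
    (Defs.iterD [:: (1, 0); (0, 1)] phi z) (Defs.iterD [:: (0, 1); (0, 1)] phi z).
  by move=> /dO Oz; exact: differentiable_has_grad (sm [:: (0, 1)] z Oz).
have [z zD|psi psiP] := @closed_form_primitive R a r
    (* The opposite of the y-derivative is put in the affine shape expected by [has_grad_affine]. *)
    (fun z => -1 * (Defs.iterD [:: (0, 1)] phi z - 0)) (Defs.iterD [:: (1, 0)] phi).
  do 3 eexists; split; first exact: has_grad_affine (gy z zD).
  have := gx z zD; congr has_grad.
  by have /eqP := lap z zD; rewrite /laplacian addr_eq0 => /eqP ->; rewrite mulN1r.
exists (fun z => (2^-1 * (phi z - phi a), 2^-1 * (psi z - psi a))); split.
- apply: cder_holomorphic => z zD.
  exists (2^-1 * Defs.iterD [:: (1, 0)] phi z, - (2^-1 * Defs.iterD [:: (0, 1)] phi z)).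
  apply/cderP => /=; split; rewrite ?opprK.
    by apply: has_grad_affine; exact: differentiable_has_grad (sm [::] z (dO _ zD)).
  have := has_grad_affine 2^-1 (psi a) (psiP z zD).
  by congr has_grad; rewrite /=; ring.
- by rewrite !subrr !mulr0.
- by move=> z _ /=; rewrite mulrA divff// mul1r.
Qed.

End gauges.

(** * Weighted norms after the substitution [f = e^H u] *)

Section extension_index.
Variable R : realType.
Notation C := (R * R)%type.
Notation mu := (@lebesgue_measure R).
Notation mu2 := (mu \x mu)%E.
Implicit Types (a z : C) (r k : R) (u f g H : C -> C) (phi : C -> R).

(* [wL2] integrates over [R * R] with the default display, whereas [mu2] lives
   on the product of two copies of [measurableTypeR R]; the identity map between
   them pushes one integral to the other. *)
Lemma wL2E (D : set C) (phi : C -> R) (f : C -> C) : open D -> holomorphic_on D f ->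
  (forall z, D z -> {for z, continuous phi}) ->
  wL2 phi D f = (\int[mu2]_(z in D) (cnorm2 (f z) * expR (- phi z))%:E)%E.
Proof.
move=> oD hf cphi.
have mD := open_measurable_plane oD.
have mf : measurable_fun D (fun z => (cnorm2 (f z) * expR (- phi z))%:E).
  by apply: (@measurable_weighted _ _ _ (fun z => - phi z)) => // z /cphi; exact: cvgN.
pose T := (measurableTypeR R * measurableTypeR R)%type.
have mid : measurable_fun (setT : set T) (fun z : T => z : C).
  by move=> _ Y mY; rewrite setTI.
apply: (@ge0_integral_pushforward _ _ T C R (fun z : T => z : C) mid mu2 D
  (fun z => (cnorm2 (f z) * expR (- phi z))%:E) mD mf) => z _.
by rewrite lee_fin mulr_ge0 ?cnorm2_ge0 ?expR_ge0.
Qed.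
(** A squared norm with Gaussian weight: [k = 0] serves the harmonic case, [k = c] and [k = - c] the
    cases of negative and positive Laplacian. *)
Definition radial_norm a r k u : \bar R :=
  (\int[mu2]_(z in disk a r) (cnorm2 (u z) * expR (k * cnorm2 (z - a)%R))%:E)%E.

Lemma continuous_quadratic a k z : {for z, continuous (fun w : C => k * cnorm2 (w - a))}.
Proof.
apply: cvgM; first exact: cvg_cst.
exact: (cder_continuous_cnorm2 (cder_shift a z)).
Qed.

Lemma measurable_radial a r k u : holomorphic_on (disk a r) u ->
  measurable_fun (disk a r) (fun z => (cnorm2 (u z) * expR (k * cnorm2 (z - a)))%:E).
Proof.
move=> hu; apply: measurable_weighted => //; first exact: open_disk.
by move=> z _; exact: continuous_quadratic.
Qed.

Lemma cnorm2_1 : cnorm2 (1, 0) = 1 :> R.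
Proof. by rewrite /cnorm2 /= expr1n expr0n /= addr0. Qed.

Lemma cnorm2_gauge H u phi z : cnorm2 (cmul (cexp (H z)) (u z)) * expR (- phi z) =
  cnorm2 (u z) * expR (2 * (H z).1 - phi z).
Proof. by rewrite cnorm2M cnorm2_cexp expRD; ring. Qed.

(** As [e^H] has no zero, take [u = e^(-H) g]. The equality is one of functions on the whole plane,
    so it can be substituted in integrals. *)
Lemma ungauge a r H g : holomorphic_on (disk a r) H -> holomorphic_on (disk a r) g ->
  H a = 0 -> exists u, [/\ holomorphic_on (disk a r) u, u a = g a &
    g = fun z => cmul (cexp (H z)) (u z)].
Proof.
move=> hH hg Ha; exists (fun z => cmul (cexp (cmul (-1, 0) (H z))) (g z)).
have H0 z : H z + cmul (-1, 0) (H z) = 0.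
  by case: (H z) => x y; rewrite /cmul; congr (_, _) => /=; ring.
split.
- apply: holomorphicM => //; apply: holomorphic_cexp; apply: holomorphicM => //.
  exact: holomorphic_cst.
- by rewrite Ha cmul0 cexp0 cmul1.
- by apply/funext => z; rewrite cmulA -cexpD H0 cexp0 cmul1.
Qed.

Lemma integral_ZexpR a r k c u : holomorphic_on (disk a r) u ->
  (\int[mu2]_(z in disk a r) ((expR c)%:E * (cnorm2 (u z) * expR (k * cnorm2 (z - a)%R))%:E)
   = (expR c)%:E * radial_norm a r k u)%E.
Proof.
move=> hu; apply: ge0_integralZl_EFin; first exact: measurable_disk.
- by move=> z _; rewrite lee_fin mulr_ge0 ?cnorm2_ge0 ?expR_ge0.
- exact: measurable_radial.
- exact: expR_ge0.
Qed.

Section gauged.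
Variables (a : C) (r k : R) (H : C -> C) (phi : C -> R).
Hypothesis hH : holomorphic_on (disk a r) H.
Hypothesis cphi : forall z, disk a r z -> {for z, continuous phi}.

Let hgauge u : holomorphic_on (disk a r) u ->
  holomorphic_on (disk a r) (fun z => cmul (cexp (H z)) (u z)).
Proof. by move=> hu; apply: holomorphicM => //; exact: holomorphic_cexp. Qed.

Lemma measurable_gauged u : holomorphic_on (disk a r) u ->
  measurable_fun (disk a r)
    (fun z => (cnorm2 (cmul (cexp (H z)) (u z)) * expR (- phi z))%:E).
Proof.
move=> hu; apply: (@measurable_weighted _ _ _ (fun z => - phi z)).
- exact: open_disk.
- exact: hgauge.
- by move=> z /cphi; exact: cvgN.
Qed.

Lemma wL2_gauge_le u : holomorphic_on (disk a r) u ->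
  (forall z, disk a r z -> 2 * (H z).1 - phi z <= - phi a + k * cnorm2 (z - a)) ->
  (wL2 phi (disk a r) (fun z => cmul (cexp (H z)) (u z)) <=
   (expR (- phi a))%:E * radial_norm a r k u)%E.
Proof.
move=> hu Hk; rewrite -integral_ZexpR// (wL2E (@open_disk R a r) (hgauge hu) cphi).
apply: ge0_le_integral; first exact: measurable_disk.
- by move=> z _; rewrite lee_fin mulr_ge0 ?cnorm2_ge0 ?expR_ge0.
- exact: measurable_gauged.
- by apply: emeasurable_funM; [exact: measurable_cst|exact: measurable_radial].
- move=> z zD; rewrite cnorm2_gauge -EFinM lee_fin mulrCA -expRD.
  by rewrite ler_wpM2l ?cnorm2_ge0// ler_expR Hk.
Qed.

Lemma wL2_gauge_ge u : holomorphic_on (disk a r) u ->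
  (forall z, disk a r z -> - phi a + k * cnorm2 (z - a) <= 2 * (H z).1 - phi z) ->
  ((expR (- phi a))%:E * radial_norm a r k u <=
   wL2 phi (disk a r) (fun z => cmul (cexp (H z)) (u z)))%E.
Proof.
move=> hu Hk; rewrite -integral_ZexpR// (wL2E (@open_disk R a r) (hgauge hu) cphi).
apply: ge0_le_integral; first exact: measurable_disk.
- by move=> z _; rewrite -EFinM lee_fin !mulr_ge0 ?cnorm2_ge0 ?expR_ge0.
- by apply: emeasurable_funM; [exact: measurable_cst|exact: measurable_radial].
- exact: measurable_gauged.
- move=> z zD; rewrite cnorm2_gauge -EFinM lee_fin mulrCA -expRD.
  by rewrite ler_wpM2l ?cnorm2_ge0// ler_expR Hk.
Qed.

End gauged.

(** Turns the pointwise inequalities [1 + t <= e^t] and [(1 + t) e^-t <= 1] into inequalities of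
    norms. *)
Lemma radial_normD_le a r k1 k2 k3 u1 u2 u3 : holomorphic_on (disk a r) u1 ->
  holomorphic_on (disk a r) u2 -> holomorphic_on (disk a r) u3 ->
  (forall z, cnorm2 (u1 z) * expR (k1 * cnorm2 (z - a)) +
     cnorm2 (u2 z) * expR (k2 * cnorm2 (z - a)) <=
     cnorm2 (u3 z) * expR (k3 * cnorm2 (z - a))) ->
  (radial_norm a r k1 u1 + radial_norm a r k2 u2 <= radial_norm a r k3 u3)%E.
Proof.
move=> h1 h2 h3 le12.
have ge0 k u z : (0 <= (cnorm2 (u z) * expR (k * cnorm2 (z - a)%R))%:E)%E.
  by rewrite lee_fin mulr_ge0 ?cnorm2_ge0 ?expR_ge0.
rewrite /radial_norm -ge0_integralD//; last 3 first.
- exact: measurable_disk.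
- exact: measurable_radial.
- exact: measurable_radial.
apply: ge0_le_integral; first exact: measurable_disk.
- by move=> z _; exact: adde_ge0.
- by apply: emeasurable_funD; exact: measurable_radial.
- exact: measurable_radial.
- by move=> z _; rewrite -EFinD lee_fin.
Qed.

Lemma radial_norm_pythagoras a r k u : 0 < r -> holomorphic_on (disk a r) u ->
  u a = (1, 0) -> (radial_norm a r k u = radial_norm a r k (fun=> (1, 0)%R) +
    radial_norm a r k (fun z => u z - (1, 0))%R)%E.
Proof.
move=> r0 hu ua; rewrite /radial_norm radial_pythagoras//; congr (_ + _)%E.
by apply: eq_integral => z _; rewrite cnorm2_1 mul1r.
Qed.

Lemma radial_norm_ge0 a r k u : (0 <= radial_norm a r k u)%E.
Proof.
by apply: integral_ge0 => z _; rewrite lee_fin mulr_ge0 ?cnorm2_ge0 ?expR_ge0.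
Qed.

Lemma radial_norm01 a r : 0 < r -> radial_norm a r 0 (fun=> (1, 0)) = (pi * r ^+ 2)%:E.
Proof.
move=> r0; rewrite -[RHS]mul1e -EFinM -(integral_disk_cst a)//.
by apply: eq_integral => z _; rewrite cnorm2_1 mul0r expR0 mulr1.
Qed.

Lemma holomorphic_line a r (c : R) : holomorphic_on (disk a r) (fun z => cmul (c, 0) (z - a)).
Proof.
apply: cder_holomorphic => z _; exists (cmul (c, 0) (1, 0)).
exact: (cderMl _ (cder_shift a z)).
Qed.

(** The quantitative gap that makes the comparisons with [bnd] strict. The disk of radius [r / 4]
    about [a + (r / 2, 0)] stays inside and at distance at least [r / 4] from [a]. *)
Lemma radial_norm_line_gt0 a r k (c : R) : 0 < r -> c != 0 -> exists2 m : R, 0 < m &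
  (m%:E <= radial_norm a r k (fun z => cmul (c, 0) (z - a))%R)%E.
Proof.
move=> r0 c0; pose m := c ^+ 2 * (r / 4) ^+ 2 * expR (- (`|k| * r ^+ 2)).
have m0 : 0 < m.
  have c2 : 0 < c ^+ 2 by rewrite exprn_even_gt0.
  have r2 : 0 < (r / 4) ^+ 2 by rewrite exprn_gt0// divr_gt0.
  by apply: mulr_gt0; [exact: mulr_gt0|exact: expR_gt0].
exists (m * (pi * (r / 4) ^+ 2)).
  by rewrite mulr_gt0// mulr_gt0 ?pi_gt0// exprn_gt0// divr_gt0.
have near z : disk (a + (r / 2, 0)) (r / 4) z -> r / 4 <= cabs (z - a) < r.
  rewrite /disk /= => zb.
  have c2 : cabs ((r / 2, 0) : C) = r / 2.
    by rewrite /cabs /cnorm2 /= expr0n /= addr0 sqrtr_sqr ger0_norm// divr_ge0// ltW.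
  have E : z - a = (z - (a + (r / 2, 0))) + (r / 2, 0) by rewrite opprD addrA subrK.
  have E' : ((r / 2, 0) : C) = (z - a) - (z - (a + (r / 2, 0))).
    by rewrite E [X in _ = X - _]addrC addrK.
  have := ler_cabsD (z - (a + (r / 2, 0))) (r / 2, 0); rewrite -E c2.
  have := ler_cabsB (z - a) (z - (a + (r / 2, 0))); rewrite -E' c2.
  by move=> ? ?; apply/andP; split; lra.
apply: (@integral_disk_ge _ a r (a + (r / 2, 0))); rewrite ?divr_gt0// ?ltW//.
- by move=> z /near /andP[].
- by apply: measurable_radial; exact: holomorphic_line.
- by move=> z _; rewrite mulr_ge0 ?cnorm2_ge0 ?expR_ge0.
move=> z /near /andP[z1 z2].
have n0 := cnorm2_ge0 (z - a).
have nr : cnorm2 (z - a) <= r ^+ 2.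
  by rewrite -sqr_cabs ler_pXn2r ?nnegrE ?cabs_ge0 ?ltW.
rewrite cnorm2M {1}/cnorm2 /= expr0n /= addr0 /m; apply: ler_pM.
- by rewrite mulr_ge0 ?sqr_ge0.
- exact: expR_ge0.
- rewrite ler_wpM2l ?sqr_ge0// -sqr_cabs ler_pXn2r ?nnegrE ?cabs_ge0//.
  by rewrite divr_ge0// ltW.
- rewrite ler_expR lerNl -mulNr; apply: (@le_trans _ _ (`|k| * cnorm2 (z - a))).
    by rewrite ler_wpM2r// -normrN ler_norm.
  by rewrite ler_wpM2l.
Qed.

(** If [u z] were nonzero, continuity would keep [cnorm2 (u _)] above half its value at [z] on a
    small disk and the integral would be positive. *)
Lemma radial_norm_eq0 a r u : holomorphic_on (disk a r) u ->
  radial_norm a r 0 u = 0%E -> forall z, disk a r z -> u z = 0.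
Proof.
move=> hu u0 z zD; apply/eqP; apply: contraT => uz.
have n0 : 0 < cnorm2 (u z) by rewrite -sqr_cabs exprn_gt0// cabs_gt0.
have [l Hl] := holomorphic_cder hu zD.
have n20 : 0 < cnorm2 (u z) / 2 by rewrite divr_gt0.
move/cvgrPdist_le : (cder_continuous_cnorm2 Hl) => /(_ _ n20) /nbhs_cabsP[d d0 Hd].
have /nbhs_cabsP[e e0 He] := open_nbhs_nbhs (conj (@open_disk R a r) zD).
have de : 0 < Num.min d e by rewrite lt_min d0.
have : ((cnorm2 (u z) / 2 * (pi * (Num.min d e) ^+ 2))%:E <= radial_norm a r 0 u)%E.
  apply: (@integral_disk_ge _ a r z); rewrite ?ltW//.
  - move=> w; rewrite /disk /= lt_min => /andP[_ we].
    by have := He _ we; rewrite addrCA subrr addr0.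
  - exact: measurable_radial.
  - by move=> w _; rewrite mulr_ge0 ?cnorm2_ge0 ?expR_ge0.
  - move=> w; rewrite /disk /= lt_min => /andP[wd _].
    have := Hd _ wd; rewrite addrCA subrr addr0 mul0r expR0 mulr1.
    by rewrite ler_norml => /andP[]; lra.
by rewrite u0 lee_fin leNgt !mulr_gt0 ?pi_gt0 ?exprn_gt0.
Qed.

Lemma bdist_disk (O : set C) a r : (r%:E < bdist O a)%E -> disk a r `<=` O.
Proof.
move=> /ereal_sup_gt[_ [s [s0 sO] <-]]; rewrite lte_fin => rs z zr.
by apply: sO; rewrite /disk /= (lt_trans zr).
Qed.

Lemma open_bdist (O : set C) a : open O -> O a -> exists2 d : R, 0 < d &
  forall r, r < d -> (r%:E < bdist O a)%E.
Proof.
move=> oO Oa; have /nbhs_cabsP[d d0 H] := open_nbhs_nbhs (conj oO Oa).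
exists d => // r rd; apply: (@lt_le_trans _ _ d%:E); first by rewrite lte_fin.
apply: ereal_sup_ubound; exists d => //; split => // z zd.
by have := H _ zd; rewrite addrCA subrr addr0.
Qed.

Lemma smooth_continuous (O : set C) phi : smooth_on O phi ->
  forall z, O z -> {for z, continuous phi}.
Proof. by move=> sm z Oz; exact: differentiable_continuous (sm [::] z Oz). Qed.

(** * The three cases: zero, negative and positive Laplacian *)

Section theorem.
Variables (O : set C) (phi : C -> R).
Hypotheses (oO : open O) (sm : smooth_on O phi).

Definition bnd a r := pi * r ^+ 2 * expR (- phi a).

Lemma bnd_gt0 a r : 0 < r -> 0 < bnd a r.
Proof. by move=> r0; rewrite !mulr_gt0 ?pi_gt0 ?exprn_gt0 ?expR_gt0. Qed.

(** An exact formula for the norm of every admissible function: the excess over [bnd] is a norm of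
    [u - 1], which gives both minimality and uniqueness. *)
Lemma harmonic_wL2 a r : 0 < r -> disk a r `<=` O ->
  (forall z, disk a r z -> laplacian phi z = 0) ->
  exists H, [/\ holomorphic_on (disk a r) H, H a = 0 &
    forall u, holomorphic_on (disk a r) u -> u a = (1, 0) ->
    (wL2 phi (disk a r) (fun z => cmul (cexp (H z)) (u z)) =
      (bnd a r)%:E + (expR (- phi a))%:E * radial_norm a r 0 (fun z => u z - (1, 0))%R)%E].
Proof.
move=> r0 dO lap; have [H [hH Ha HE]] := harmonic_gauge sm dO lap.
exists H; split => // u hu ua.
have cphi z : disk a r z -> {for z, continuous phi}.
  by move=> /dO; exact: (smooth_continuous sm).
transitivity ((expR (- phi a))%:E * radial_norm a r 0 u)%E.
  apply/le_anti/andP; split.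
    by apply: wL2_gauge_le => // z zD; rewrite HE// mul0r addr0; lra.
  by apply: wL2_gauge_ge => // z zD; rewrite HE// mul0r addr0; lra.
rewrite radial_norm_pythagoras// radial_norm01// ge0_muleDr ?radial_norm_ge0//; last first.
  by rewrite lee_fin mulr_ge0 ?pi_ge0 ?sqr_ge0.
by rewrite -EFinM /bnd [expR _ * _]mulrC.
Qed.

(** The gap [m] is the same for all [g], so it survives the infimum defining the index and also
    excludes any extension within the bound. *)
Lemma laplacian_lt0_wL2 a : O a -> laplacian phi a < 0 -> exists r m,
  [/\ 0 < r, (r%:E < bdist O a)%E, 0 < m &
   forall g, holomorphic_on (disk a r) g -> g a = (1, 0) ->
     ((bnd a r + m)%:E <= wL2 phi (disk a r) g)%E].
Proof.
move=> Oa lap; have [H [hH Ha HT]] := taylor_gauge oO sm Oa.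
(* Half of the quadratic coefficient [- laplacian phi a / 4]: the Taylor error with tolerance [c]
   consumes the other half. *)
pose c := - laplacian phi a / 8; have c0 : 0 < c by rewrite /c; lra.
have [d d0 Hd] := HT c c0; have [e e0 He] := open_bdist oO Oa.
pose r := Num.min d e / 2.
have de : 0 < Num.min d e by rewrite lt_min d0.
have r0 : 0 < r by rewrite divr_gt0.
have rde : r < Num.min d e by rewrite /r; lra.
have [rd re] : r < d /\ r < e by move: rde; rewrite lt_min => /andP.
have s0 : Num.sqrt c != 0 by rewrite gt_eqF// sqrtr_gt0.
(* The slope [Num.sqrt c] makes the squared modulus of the linear function equal to
   [c * cnorm2 (z - a)], the second term in [1 + t <= e^t]. *)
have [m m0 mle] := @radial_norm_line_gt0 a r 0 (Num.sqrt c) r0 s0.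
have rO := bdist_disk (He r re).
have cphi z : disk a r z -> {for z, continuous phi}.
  by move=> /rO; exact: (smooth_continuous sm).
exists r, (expR (- phi a) * m); split => //; first exact: He.
  by rewrite mulr_gt0 ?expR_gt0.
move=> g hg ga; have [u [hu ua ->]] := ungauge (hH _) hg Ha.
apply: le_trans (@wL2_gauge_ge a r c H phi (hH _) cphi u hu _); last first.
  move=> z zD; have zd : disk a d z by rewrite /disk /= (lt_trans zD).
  have := Hd z zd; rewrite ler_norml => /andP[_].
  by rewrite /c; have := cnorm2_ge0 (z - a); lra.
have -> : bnd a r + expR (- phi a) * m = expR (- phi a) * (pi * r ^+ 2 + m).
  by rewrite /bnd; ring.
rewrite EFinM; apply: lee_wpmul2l; first by rewrite lee_fin expR_ge0.
rewrite radial_norm_pythagoras ?ua//.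
apply: (@le_trans _ _ (radial_norm a r c (fun=> (1, 0)%R))); last first.
  by rewrite leeDl// radial_norm_ge0.
rewrite EFinD; apply: (le_trans (leeD (lexx _) mle)).
rewrite -(radial_norm01 a r0).
have hl := @holomorphic_line a r (Num.sqrt c).
apply: radial_normD_le => //; try exact: holomorphic_cst.
move=> z; rewrite cnorm2M cnorm2_1 {2}/cnorm2 /=.
rewrite (sqr_sqrtr (ltW c0)) expr0n /= addr0 mul0r expR0 !mulr1 mul1r.
exact: expR_ge1Dx.
Qed.

(** [f1] forces the index below 1, while [f1] and [f2] together contradict uniqueness. By Pythagoras
    the norm of [u] exceeds that of 1 by the norm of its linear part; bounding the former by
    [pi * r ^+ 2] therefore leaves a gap for [f1]. *)
Lemma laplacian_gt0_wL2 a : O a -> 0 < laplacian phi a -> exists r m f1 f2,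
  [/\ 0 < r, (r%:E < bdist O a)%E & 0 < m] /\
  [/\ holomorphic_on (disk a r) f1, f1 a = (1, 0) &
    (wL2 phi (disk a r) f1 <= (bnd a r - m)%:E)%E] /\
  [/\ holomorphic_on (disk a r) f2, f2 a = (1, 0) &
    (wL2 phi (disk a r) f2 <= (bnd a r)%:E)%E] /\
  exists2 z, disk a r z & f1 z <> f2 z.
Proof.
move=> Oa lap; have [H [hH Ha HT]] := taylor_gauge oO sm Oa.
pose c := laplacian phi a / 8; have c0 : 0 < c by rewrite /c; lra.
have [d d0 Hd] := HT c c0; have [e e0 He] := open_bdist oO Oa.
pose r := Num.min d e / 2.
have de : 0 < Num.min d e by rewrite lt_min d0.
have r0 : 0 < r by rewrite divr_gt0.
have rde : r < Num.min d e by rewrite /r; lra.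
have [rd re] : r < d /\ r < e by move: rde; rewrite lt_min => /andP.
have s0 : Num.sqrt c != 0 by rewrite gt_eqF// sqrtr_gt0.
have [m m0 mle] := @radial_norm_line_gt0 a r (- c) (Num.sqrt c) r0 s0.
have rO := bdist_disk (He r re).
have cphi z : disk a r z -> {for z, continuous phi}.
  by move=> /rO; exact: (smooth_continuous sm).
pose u z := (1, 0) + cmul (Num.sqrt c, 0) (z - a).
have hl := @holomorphic_line a r (Num.sqrt c).
have h1 := @holomorphic_cst R (disk a r) (1, 0).
have hu : holomorphic_on (disk a r) u by exact: holomorphicD.
have ua : u a = (1, 0) by rewrite /u subrr cmul0 addr0.
have Hk z : disk a r z -> 2 * (H z).1 - phi z <= - phi a + - c * cnorm2 (z - a).
  move=> zD; have zd : disk a d z by rewrite /disk /= (lt_trans zD).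
  have := Hd z zd; rewrite ler_norml => /andP[+ _].
  by rewrite /c; have := cnorm2_ge0 (z - a); lra.
have uE : radial_norm a r (- c) u = (radial_norm a r (- c) (fun=> (1, 0)%R) +
    radial_norm a r (- c) (fun z => cmul (Num.sqrt c, 0) (z - a))%R)%E.
  rewrite radial_norm_pythagoras//; congr (_ + radial_norm _ _ _ _)%E.
  by apply/funext => z; rewrite /u addrC addKr.
(* Pointwise this is [(1 + t) e^-t <= 1] with [t = c * cnorm2 (z - a)]. *)
have ule : (radial_norm a r (- c) u <= (pi * r ^+ 2)%:E)%E.
  rewrite uE -(radial_norm01 a r0); apply: radial_normD_le => // z.
  rewrite cnorm2M cnorm2_1 {2}/cnorm2 /=.
  rewrite (sqr_sqrtr (ltW c0)) expr0n /= addr0 mul0r expR0 !mulr1 -mulrDl.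
  by rewrite mulNr expRN ler_pdivrMr ?expR_gt0// mul1r expR_ge1Dx.
exists r, (expR (- phi a) * m), (fun z => cmul (cexp (H z)) (1, 0)),
  (fun z => cmul (cexp (H z)) (u z)).
have hE : holomorphic_on (disk a r) (fun z => cexp (H z)) by exact: holomorphic_cexp.
split; first by split => //; [exact: He|rewrite mulr_gt0 ?expR_gt0].
split; [split|split; [split|]].
- exact: holomorphicM.
- by rewrite Ha cexp0 cmul1.
- apply: (le_trans (wL2_gauge_le (hH _) cphi h1 Hk)).
  have -> : bnd a r - expR (- phi a) * m = expR (- phi a) * (pi * r ^+ 2 - m).
    by rewrite /bnd; ring.
  rewrite EFinM; apply: lee_wpmul2l; first by rewrite lee_fin expR_ge0.
  rewrite EFinB leeBrDr//; apply: le_trans ule; rewrite uE.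
  exact: leeD.
- exact: holomorphicM.
- by rewrite Ha cexp0 cmul1.
- apply: (le_trans (wL2_gauge_le (hH _) cphi hu Hk)).
  by rewrite /bnd mulrC EFinM; apply: lee_wpmul2l; rewrite // lee_fin expR_ge0.
exists (a + (r / 2, 0)).
  rewrite /disk /= addrAC subrr add0r /cabs /cnorm2 /= expr0n /= addr0 sqrtr_sqr.
  by rewrite ger0_norm ?divr_ge0 ?ltW//; lra.
rewrite /u; move: (H _) => w E.
(* Multiplying by [e^(-w)] removes the common factor; what remains is [Num.sqrt c * (r / 2) = 0]. *)
have : cmul (cexp (- w)) (cmul (cexp w) (1, 0)) = cmul (cexp (- w)) (cmul (cexp w)
   ((1, 0) + cmul (Num.sqrt c, 0) (a + (r / 2, 0) - a))) by rewrite E.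
rewrite !cmulA -cexpD addNr cexp0 !cmul1 addrAC subrr add0r => -[] /=.
rewrite mul0r subr0 => /eqP; rewrite -subr_eq0 opprD addrA subrr add0r oppr_eq0.
by rewrite mulf_eq0 (negbTE s0) mulf_eq0 invr_eq0 pnatr_eq0 orbF gt_eqF.
Qed.

End theorem.
End extension_index.

(** * The two equivalences *)

Theorem theorem1p7 (R : realType) (Omega : set (R * R)%type) (phi : (R * R)%type -> R)
  (Omega_open : open Omega) (Omega_connected : connected Omega)
  (Omega_nonempty : Omega !=set0) (phi_smooth : smooth_on Omega phi) :
  ((forall z, Omega z -> laplacian phi z = 0) <->
   (forall (a : (R * R)%type) (r : R), Omega a -> 0 < r -> (r%:E < bdist Omega a)%E ->
      L2index phi a r = 1%E)) /\
  ((forall z, Omega z -> laplacian phi z = 0) <->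
   (forall (a : (R * R)%type) (r : R), Omega a -> 0 < r -> (r%:E < bdist Omega a)%E ->
      exists f : (R * R)%type -> (R * R)%type,
        [/\ holomorphic_on (disk a r) f, f a = (1, 0)
          & (wL2 phi (disk a r) f <= (pi * r ^+ 2 * expR (- phi a))%:E)%E] /\
        forall g : (R * R)%type -> (R * R)%type,
          [/\ holomorphic_on (disk a r) g, g a = (1, 0)
            & (wL2 phi (disk a r) g <= (pi * r ^+ 2 * expR (- phi a))%:E)%E] ->
          forall z, disk a r z -> g z = f z)).
Proof.
(* The extremal function [e^H] is kept as a product with the constant 1, to match the form [e^H u]
   of [harmonic_wL2]. *)
have wf1 (a : R * R) (r : R) (H : R * R -> R * R) : H a = 0 -> holomorphic_on (disk a r) H ->
    holomorphic_on (disk a r) (fun z => cmul (cexp (H z)) (1, 0)) /\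
    cmul (cexp (H a)) (1, 0) = (1, 0).
  move=> Ha hH; rewrite Ha cexp0 cmul1; split => //.
  by apply: holomorphicM; [exact: holomorphic_cexp|exact: holomorphic_cst].
have rad0 (a : R * R) (r : R) : radial_norm a r 0 (fun=> (1, 0) - (1, 0))%R = 0%E.
  apply: integral0_eq => z _; rewrite subrr.
  by rewrite /cnorm2 /= expr0n /= addr0 mul0r.
split; split.
- move=> lap a r Oa r0 rO; have dO := bdist_disk rO.
  have [H [hH Ha HE]] := harmonic_wL2 phi_smooth r0 dO (fun z zD => lap z (dO z zD)).
  have N0 := bnd_gt0 phi a r0.
  have NV : ((bnd phi a r)%:E * ((bnd phi a r)^-1)%:E = 1)%E.
    by rewrite -EFinM divff ?gt_eqF.
  have [h1 h1a] := wf1 a r H Ha hH.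
  have W1 : wL2 phi (disk a r) (fun z => cmul (cexp (H z)) (1, 0)) = (bnd phi a r)%:E.
    by rewrite (HE (fun=> (1, 0)))//; [rewrite rad0 mule0 adde0|exact: holomorphic_cst].
  apply/le_anti/andP; split.
    apply: ereal_inf_lbound; exists (fun z => cmul (cexp (H z)) (1, 0)).
      by split => //; split => //; rewrite W1 ltry.
    by rewrite W1.
  apply: le_ereal_inf_tmp => _ [g [[hg _] ga] <-].
  have [u [hu ua ->]] := ungauge hH hg Ha.
  rewrite -NV; apply: lee_wpmul2r; first by rewrite lee_fin invr_ge0 ltW.
  rewrite HE// ?ua//; rewrite leeDl// mule_ge0 ?radial_norm_ge0// lee_fin expR_ge0.
- move=> L1 z Oz; apply/eqP; apply: contraT; rewrite neq_lt => /orP[lap|lap].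
    have [r [m [r0 rO m0 Hg]]] := laplacian_lt0_wL2 Omega_open phi_smooth Oz lap.
    have N0 := bnd_gt0 phi z r0.
    have : (((bnd phi z r + m) / bnd phi z r)%:E <= L2index phi z r)%E.
      apply: le_ereal_inf_tmp => _ [g [[hg _] ga] <-].
      rewrite EFinM; apply: lee_wpmul2r; first by rewrite lee_fin invr_ge0 ltW.
      exact: Hg.
    rewrite L1// lee_fin ler_pdivrMr// mul1r; lra.
  have [r [m [f1 [f2 [[r0 rO m0] [[h1 f1a W1] _]]]]]] :=
    laplacian_gt0_wL2 Omega_open phi_smooth Oz lap.
  have N0 := bnd_gt0 phi z r0.
  have : (L2index phi z r <= ((bnd phi z r - m) / bnd phi z r)%:E)%E.
    apply: (@le_trans _ _ (wL2 phi (disk z r) f1 * ((bnd phi z r)^-1)%:E)%E).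
      apply: ereal_inf_lbound; exists f1 => //; split => //; split => //.
      by apply: (le_lt_trans W1); rewrite ltry.
    by rewrite EFinM; apply: lee_wpmul2r => //; rewrite lee_fin invr_ge0 ltW.
  rewrite L1// lee_fin ler_pdivlMr// mul1r; lra.
- move=> lap a r Oa r0 rO; have dO := bdist_disk rO.
  have [H [hH Ha HE]] := harmonic_wL2 phi_smooth r0 dO (fun z zD => lap z (dO z zD)).
  have [h1 h1a] := wf1 a r H Ha hH.
  exists (fun z => cmul (cexp (H z)) (1, 0)); split.
    split => //; rewrite (HE (fun=> (1, 0)))//; last exact: holomorphic_cst.
    by rewrite rad0 mule0 adde0.
  move=> g [hg ga]; have [u [hu ua ->]] := ungauge hH hg Ha.
  rewrite HE// ?ua//; set X := radial_norm _ _ _ _ => W z zD.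
  have X0 : (0 <= X)%E by exact: radial_norm_ge0.
  (* The finite term [bnd phi a r] cancels from both sides of [W], leaving only the norm of
     [u - 1]. *)
  have EX : ((expR (- phi a))%:E * X <= 0)%E.
    by move: W; rewrite -[leRHS]adde0 leeD2lE.
  have {}X0 : X = 0%E.
    apply/le_anti; rewrite X0 andbT.
    by move: EX; rewrite pmule_rle0// lte_fin expR_gt0.
  have hu1 : holomorphic_on (disk a r) (fun z => u z - (1, 0)).
    by apply: holomorphicD => //; exact: holomorphic_cst.
  have /eqP := radial_norm_eq0 hu1 X0 zD.
  by rewrite subr_eq0 => /eqP ->.
- move=> ex z Oz; apply/eqP; apply: contraT; rewrite neq_lt => /orP[lap|lap].
    have [r [m [r0 rO m0 Hg]]] := laplacian_lt0_wL2 Omega_open phi_smooth Oz lap.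
    have [f [[hf fz Wf] _]] := ex z r Oz r0 rO.
    have := le_trans (Hg f hf fz) Wf; rewrite lee_fin /bnd; lra.
  have [r [m [f1 [f2 [[r0 rO m0] [[h1 f1a W1] [[h2 f2a W2] [w wD f12]]]]]]]] :=
    laplacian_gt0_wL2 Omega_open phi_smooth Oz lap.
  have [f [_ uf]] := ex z r Oz r0 rO.
  (* The strict bound on [f1] is weakened so that [f1] and [f2] both compete with the unique [f]. *)
  have {}W1 : (wL2 phi (disk z r) f1 <= (bnd phi z r)%:E)%E.
    by apply: (le_trans W1); rewrite lee_fin gerBl ltW.
  case: f12; transitivity (f w); first exact: (uf f1 (And3 h1 f1a W1)).
  exact/esym/(uf f2 (And3 h2 f2a W2)).
Qed.
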